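(* There is an absolute constant $C>0$ such that for all integers $T\ge 2$ and $d\ge 1$ there exists an efficient forecasting algorithm for the $T$-round online protocol with context space $\mathcal X=\{x\in\mathbb R^d:\|x\|_2\le 1,\ x_1=\tfrac12\}$ (making predictions in $\mathcal Z=\{0,\frac1N,\dots,\frac{N-1}{N},1\}$ for a suitable positive integer $N$ chosen by the algorithm) such that, for every oblivious adversary and every $\delta\in(0,1)$, with probability at least $1-\delta$, $$\mathsf{SReg}_{\mathcal F_4^{\mathrm{lin}}}\le C\left(T^{\frac35}(d\log T)^{\frac25}+T^{\frac35}(d\log T)^{-\frac1{10}}\sqrt{\log\frac1\delta}\right).$$ Furthermore, $\mathbb E\big[\mathsf{SReg}_{\mathcal F_4^{\mathrm{lin}}}\big]\le C\,T^{\frac35}(d\log T)^{\frac25}$, where the expectation is over the internal randomness of the algorithm.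
   Context: Online protocol. There are $T$ rounds ($T$ known). An oblivious adversary fixes a sequence $(x_1,y_1),\dots,(x_T,y_T)\in\mathcal X\times\{0,1\}$ in advance (knowing the forecaster's algorithm but not its random draws). In round $t$: the context $x_t$ is revealed; the forecaster chooses a distribution $\mathcal P_t$ on $\mathcal Z$ and draws a prediction $p_t\sim\mathcal P_t$; then $y_t$ is revealed. Function class. $\mathcal F^{\mathrm{lin}}=\{x\mapsto\langle\theta,x\rangle:\theta\in\mathbb R^d\}$ and $\mathcal F_4^{\mathrm{lin}}=\{f\in\mathcal F^{\mathrm{lin}}: f(x)^2\le 4\ \text{for all }x\in\mathcal X\}$. Contextual swap regret (for the squared loss): $$\mathsf{SReg}_{\mathcal F}=\sup_{\{f_p\in\mathcal F\}_{p\in\mathcal Z}}\sum_{t=1}^T\Big((p_t-y_t)^2-(f_{p_t}(x_t)-y_t)^2\Big).$$ ''Efficient'' means running time polynomial in $T$ and $d$. *)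

(* Defs.v *)
From HB Require Import structures.
From mathcomp Require Import all_boot all_order all_algebra.
From mathcomp Require Import boolp classical_sets reals exp.

Set Implicit Arguments.
Unset Strict Implicit.
Unset Printing Implicit Defensive.

Import Order.TTheory GRing.Theory Num.Theory.

Local Open Scope ring_scope.
Local Open Scope classical_set_scope.

Section Protocol.
Variables (R : realType) (d N : nat).

Definition context := 'rV[R]_d.

(* The prediction k/N of the grid Z is represented by its index k : 'I_N.+1. *)
Definition grid (k : 'I_N.+1) : R := k%:R / N%:R.

Definition round := (context * 'I_N.+1 * bool)%type.

(* The pmf used on the current context after a given history of completed
   rounds (oldest round first). *)
Definition forecaster := seq round -> context -> 'I_N.+1 -> R.

Definition is_distribution (q : 'I_N.+1 -> R) : Prop :=
  (forall k, 0 <= q k) /\ \sum_k q k = 1.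

Section Oblivious.
Variables (T : nat) (A : forecaster).
Variables (x : 'I_T -> context) (y : 'I_T -> bool).

Definition draws := {ffun 'I_T -> 'I_N.+1}.

Definition transcript (w : draws) : seq round :=
  [seq (x t, w t, y t) | t <- enum 'I_T].

Definition chosen_dist (w : draws) (t : 'I_T) : 'I_N.+1 -> R :=
  A (take t (transcript w)) (x t).

(* Law of (p_1, ..., p_T), where p_t is drawn from P_t given the past. *)
Definition draws_mass (w : draws) : R := \prod_t chosen_dist w t (w t).

Definition Pr (E : pred draws) : R := \sum_(w | E w) draws_mass w.

Definition Ex (Y : draws -> R) : R := \sum_w draws_mass w * Y w.

(* The sums are bounded above by \sum_t (p_t - y_t)^2, so the real supremum is
   the actual one as soon as F is nonempty. *)
Definition SReg (F : set (context -> R)) (w : draws) : R :=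
  sup [set \sum_t ((grid (w t) - (y t)%:R) ^+ 2
                   - (f (w t) (x t) - (y t)%:R) ^+ 2)
      | f in [set f : 'I_N.+1 -> context -> R | forall k, F (f k)]].

End Oblivious.

Definition l2norm (v : context) : R := Num.sqrt (\sum_i v 0 i ^+ 2).

Definition contexts : set context :=
  [set v | l2norm v <= 1 /\
           forall i : 'I_d, i = 0%N :> nat -> v 0 i = 2^-1].

Definition Flin : set (context -> R) :=
  [set f | exists theta : 'rV[R]_d, forall v : context, f v = \sum_i theta 0 i * v 0 i].

Definition Flin4 : set (context -> R) :=
  [set f | Flin f /\ forall v : context, contexts v -> f v ^+ 2 <= 4].

End Protocol.

(* A real RAM.  Programs are finite syntactic objects acting on two sorts of storage:
   registers holding natural numbers, and arrays of reals whose cells are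
   addressed by lists of natural numbers.  There is no conversion from reals
   to naturals and no multiplication of naturals, and the only real constants
   are (casts of) naturals.  Every loop has a bound fixed on entry, so that all
   programs terminate; this only restricts the available algorithms.  Division
   by zero yields zero. *)

Inductive nexp :=
  | NConst of nat
  | NReg of nat
  | NAdd of nexp & nexp
  | NSub of nexp & nexp.

Inductive rexp :=
  | RNat of nexp
  | RCell of nat & seq nexp
  | RAdd of rexp & rexp
  | RSub of rexp & rexp
  | RMul of rexp & rexp
  | RDiv of rexp & rexp.

Inductive bexp :=
  | NLe of nexp & nexp
  | RLe of rexp & rexp
  | BNot of bexp
  | BAnd of bexp & bexp.

Inductive cmd :=
  | Skip
  | NSet of nat & nexp
  | RSet of nat & seq nexp & rexp
  | Seq of cmd & cmd
  | If of bexp & cmd & cmd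
  | For of nat & nexp & cmd. (* [For r e c]: register r runs through 0..e-1 *)

Section Semantics.
Variable R : realType.

Record memory := Memory {
  nreg : nat -> nat;
  cell : nat -> seq nat -> R }.

Definition set_nreg (r n : nat) (m : memory) : memory :=
  Memory (fun r' => if r' == r then n else nreg m r') (cell m).

Definition set_cell (a : nat) (idx : seq nat) (v : R) (m : memory) : memory :=
  Memory (nreg m)
    (fun a' idx' => if (a' == a) && (idx' == idx) then v else cell m a' idx').

Fixpoint neval (m : memory) (e : nexp) : nat :=
  match e with
  | NConst n => n
  | NReg r => nreg m r
  | NAdd e1 e2 => (neval m e1 + neval m e2)%N
  | NSub e1 e2 => (neval m e1 - neval m e2)%N
  end.

Fixpoint reval (m : memory) (e : rexp) : R :=
  match e with
  | RNat e => (neval m e)%:R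
  | RCell a idx => cell m a (map (neval m) idx)
  | RAdd e1 e2 => reval m e1 + reval m e2
  | RSub e1 e2 => reval m e1 - reval m e2
  | RMul e1 e2 => reval m e1 * reval m e2
  | RDiv e1 e2 => reval m e1 / reval m e2
  end.

Fixpoint beval (m : memory) (b : bexp) : bool :=
  match b with
  | NLe e1 e2 => (neval m e1 <= neval m e2)%N
  | RLe e1 e2 => reval m e1 <= reval m e2
  | BNot b => ~~ beval m b
  | BAnd b1 b2 => beval m b1 && beval m b2
  end.

Definition loop (body : memory -> memory) (r n : nat) (m : memory) : memory :=
  iteri n (fun i m' => body (set_nreg r i m')) m.

Fixpoint run (c : cmd) (m : memory) : memory :=
  match c with
  | Skip => m
  | NSet r e => set_nreg r (neval m e) m
  | RSet a idx e => set_cell a (map (neval m) idx) (reval m e) m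
  | Seq c1 c2 => run c2 (run c1 m)
  | If b c1 c2 => if beval m b then run c1 m else run c2 m
  | For r e c => loop (run c) r (neval m e) m
  end.

(* Unit cost for each arithmetic operation, comparison, memory access (plus
   its index computations), assignment, test and loop iteration. *)

Fixpoint ncost (e : nexp) : nat :=
  match e with
  | NConst _ | NReg _ => 1
  | NAdd e1 e2 | NSub e1 e2 => (ncost e1 + ncost e2).+1
  end.

Definition idxcost (idx : seq nexp) : nat := (sumn (map ncost idx)).+1.

Fixpoint rcost (e : rexp) : nat :=
  match e with
  | RNat e => (ncost e).+1
  | RCell _ idx => idxcost idx
  | RAdd e1 e2 | RSub e1 e2 | RMul e1 e2 | RDiv e1 e2 =>
      (rcost e1 + rcost e2).+1
  end.

Fixpoint bcost (b : bexp) : nat :=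
  match b with
  | NLe e1 e2 => (ncost e1 + ncost e2).+1
  | RLe e1 e2 => (rcost e1 + rcost e2).+1
  | BNot b => (bcost b).+1
  | BAnd b1 b2 => (bcost b1 + bcost b2).+1
  end.

Fixpoint cost (c : cmd) (m : memory) : nat :=
  match c with
  | Skip => 1
  | NSet _ e => (ncost e).+1
  | RSet _ idx e => (idxcost idx + rcost e)%N
  | Seq c1 c2 => (cost c1 m + cost c2 (run c1 m))%N
  | If b c1 c2 => (bcost b + if beval m b then cost c1 m else cost c2 m)%N
  | For r e c =>
      (ncost e + \sum_(i < neval m e)
         (cost c (set_nreg r i (loop (run c) r i m))).+1)%N
  end.

End Semantics.

(* Interface with the protocol: registers 0, 1 initially hold T and d;
   [init_code] leaves N in register 2.  In each round the context is written to
   cells [0] .. [d-1] of array 0 and [predict_code] is run, which leaves the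
   probability of k/N in cell [k] of array 1; then the index of the drawn
   prediction and the outcome are written to registers 3 and 4, and
   [update_code] is run.  The memory persists throughout. *)

Record program := Program {
  init_code : cmd;
  predict_code : cmd;
  update_code : cmd }.

Section Execution.
Variables (R : realType) (P : program) (T d : nat).

Definition start : memory R :=
  set_nreg 1 d (set_nreg 0 T (Memory (fun=> 0%N) (fun _ _ => 0))).

Definition after_init : memory R := run (init_code P) start.

Definition grid_size : nat := nreg after_init 2.

Definition load_context (v : context R d) (m : memory R) : memory R :=
  foldr (fun i => set_cell 0 [:: val i] (v 0 i)) m (enum 'I_d).

Definition after_predict (v : context R d) (m : memory R) : memory R :=
  run (predict_code P) (load_context v m).

Definition load_outcome (k : nat) (b : bool) (m : memory R) : memory R :=
  set_nreg 4 b (set_nreg 3 k m).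

Definition after_round N (m : memory R) (r : round R d N) : memory R :=
  let: (v, k, b) := r in
  run (update_code P) (load_outcome k b (after_predict v m)).

Definition forecaster_of N : forecaster R d N :=
  fun h v k => cell (after_predict v (foldl (@after_round N) after_init h))
                    1 [:: val k].

(* d and N + 1 account for reading the context and for sampling. *)
Definition round_cost N (m : memory R) (r : round R d N) : nat :=
  let: (v, k, b) := r in
  (d + cost (predict_code P) (load_context v m) + N.+1
   + cost (update_code P) (load_outcome k b (after_predict v m)))%N.

Fixpoint rounds_cost N (m : memory R) (h : seq (round R d N)) : nat :=
  if h is r :: h' then (round_cost m r + rounds_cost (after_round m r) h')%N
  else 0%N.

Definition running_time N (h : seq (round R d N)) : nat :=
  (cost (init_code P) start + rounds_cost after_init h)%N.

End Execution.

(* Running time polynomial in T and d, uniformly in the adversary and the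
   draws. *)
Definition efficient (R : realType) (P : program) : Prop :=
  exists c : nat, forall T d : nat, (2 <= T)%N -> (1 <= d)%N ->
  forall (x : 'I_T -> context R d) (y : 'I_T -> bool)
         (w : draws (grid_size R P T d) T),
  (forall t, contexts (x t)) ->
  (running_time P T (transcript x y w) <= c * (T + d) ^ c)%N.

(* Main.v *)
Require Import Defs.
From mathcomp Require Import all_boot all_order all_algebra.
From mathcomp Require Import boolp classical_sets reals exp.
From mathcomp Require Import sequences ring lra zify.
Import Order.TTheory GRing.Theory Num.Theory.
Local Open Scope ring_scope.

Set Implicit Arguments.
Unset Strict Implicit.
Unset Printing Implicit Defensive.

(** Every grid point p owns a Vovk-Azoury-Warmuth ridge forecaster that is fed
    only with the rounds in which p was actually drawn; let w_p be its clipped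
    prediction.  For every realisation of the draws and all f_p in the class,
    the regret of p's forecaster on those rounds is at most
    |theta_p|^2 + ln det (Gram matrix) = O(d log T), so that
      SReg <= sum_t [(p_t - y_t)^2 - (w_{p_t} - y_t)^2] + (N + 1) O(d log T),
    and no uniform convergence over the class is needed.  Since w_0 >= 0 and
    w_1 <= 1, there are neighbouring grid points with w_i >= i/N and
    w_{i+1} < (i+1)/N (or w_1 = 1); drawing between them so that w_p - p has
    mean zero makes the conditional mean of each summand at most 1/(4N^2)
    whatever y_t is.  An exponential supermartingale then yields
      SReg <= O(N d log T) + T/(4N^2) + sqrt(8 T log (1/delta)),
    and N of order sqrt(T/(d log T)) suffices; for d log T > T the bound is
    trivial because SReg <= T. *)

(** * Determinants of positive definite matrices *)

Definition qform (K : comNzRingType) n (A : 'M[K]_n) (v : 'rV[K]_n) : K :=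
  (v *m A *m v^T) 0 0.

Definition posdef (K : realFieldType) n (A : 'M[K]_n) : Prop :=
  A^T = A /\ forall v, v != 0 -> 0 < qform A v.

(** Matrix determinant lemma: [M *m U] and [U *m M] are both block triangular and have the same
    determinant. *)
Lemma det_1mulmx (K : comUnitRingType) n (u : 'cV[K]_n) (v : 'rV[K]_n) :
  \det (1%:M + u *m v) = 1 + (v *m u) 0 0.
Proof.
pose M : 'M_(n + 1) := block_mx 1%:M (- u) v 1%:M.
pose U : 'M_(n + 1) := block_mx 1%:M u 0 1%:M.
have dU : \det U = 1 by rewrite det_ublock !det1 mulr1.
have e1 : M *m U = block_mx 1%:M 0 v (v *m u + 1%:M).
  by rewrite mulmx_block !mulmx1 !mul1mx !mulmx0 !addr0 subrr.
have e2 : U *m M = block_mx (1%:M + u *m v) 0 v 1%:M.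
  by rewrite mulmx_block !mulmx1 !mul1mx !mul0mx !add0r addNr.
have := congr1 determinant e2; rewrite det_mulmx dU mul1r det_lblock det1 mulr1.
move=> <-; have := congr1 determinant e1.
rewrite det_mulmx dU mulr1 det_lblock det1 mul1r => ->.
by rewrite det_mx11 !mxE eqxx addrC.
Qed.

Lemma qform_block (K : comNzRingType) m n (a : 'M[K]_m) v w (B : 'M[K]_n) c z :
  qform (block_mx a v w B) (row_mx c z) =
  ((c *m a + z *m w) *m c^T + (c *m v + z *m B) *m z^T) 0 0.
Proof. by rewrite /qform mul_row_block tr_row_mx mul_row_col. Qed.

(** Hadamard's inequality, by induction through the Schur complement [S] of the top left entry [k]:
    the determinant is [k * \det S], [S] is again positive definite, and its diagonal is dominated
    by that of [B]. *)
Lemma posdef_det (K : realFieldType) n (A : 'M[K]_n) :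
  posdef A -> 0 < \det A <= \prod_i A i i.
Proof.
elim: n A => [|n IH] A [symA posA].
  by rewrite det_mx00 big_ord0 ltr01 lexx.
move: symA posA; rewrite -[A](@submxK _ 1 n 1 n).
move: (ulsubmx (A : 'M_(1 + n))) (ursubmx (A : 'M_(1 + n))).
move: (dlsubmx (A : 'M_(1 + n))) (drsubmx (A : 'M_(1 + n))) => w B a v {A}.
rewrite (@tr_block_mx _ 1 n 1 n) => /(@eq_block_mx _ 1 n 1 n)[_ wv vw BB] posA.
pose k := a 0 0.
have ak : a = k%:M by rewrite [a]mx11_scalar.
have k0 : 0 < k.
  have nz : row_mx (1%:M : 'M[K]_1) (0 : 'rV[K]_n) != 0.
    apply/eqP => /matrixP /(_ 0 (lshift n 0)).
    by rewrite row_mxEl !mxE eqxx => /eqP; rewrite oner_eq0.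
  have : 0 < qform (block_mx a v w B) (row_mx 1%:M 0) := posA _ nz.
  rewrite qform_block.
  by rewrite !trmx0 !mulmx0 trmx1 mulmx1 mul1mx !mul0mx !addr0.
have kn : k != 0 by rewrite gt_eqF.
pose S := B - k^-1 *: (w *m v).
have detA : \det (block_mx a v w B) = k * \det S.
  have -> : block_mx a v w B =
     (block_mx 1%:M 0 (k^-1 *: w) 1%:M : 'M_(1 + n)) *m (block_mx a v 0 S).
    rewrite mulmx_block !mul1mx !mul0mx !addr0 /S ak.
    rewrite mul_mx_scalar scalerA mulfV // scale1r -scalemxAl.
    by rewrite addrC subrK.
  rewrite det_mulmx det_lblock !det1 !mul1r det_ublock.
  by rewrite [a]mx11_scalar det_scalar1.
have posS : posdef S.
  split.
    by rewrite /S linearB /= linearZ /= trmx_mul BB wv vw.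
  move=> z nz.
  (* This first coordinate minimises the form, so its value at [row_mx c z] is the form of [S] at
     [z]. *)
  pose c := - (k^-1 *: (z *m w)) : 'rV[K]_1.
  have nz' : row_mx c z != 0.
    apply: contraNneq nz => /(congr1 rsubmx).
    by rewrite row_mxKr => ->; rewrite linear0.
  have : 0 < qform (block_mx a v w B) (row_mx c z) := posA _ nz'.
  rewrite qform_block.
  suff -> : (c *m a + z *m w) = 0.
    suff -> : (c *m v + z *m B) = z *m S by rewrite mul0mx add0r.
    rewrite /S mulmxBr addrC; congr (_ + _).
    by rewrite /c mulNmx -scalemxAl -scalemxAr mulmxA.
  by rewrite /c ak mul_mx_scalar scalerN scalerA mulfV // scale1r addNr.
have /andP[dS leS] := IH _ posS.
rewrite detA big_ord_recl /= mulr_gt0 //=.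
have -> : (block_mx a v w B : 'M_(1 + n)) ord0 ord0 = k.
  have -> : ord0 = lshift n (0 : 'I_1) by apply: val_inj.
  by apply: block_mxEul.
rewrite ler_pM2l //; apply: le_trans leS _.
apply: ler_prod => i _; have Ei : lift ord0 i = rshift 1 i by apply: val_inj.
have delta_nz : delta_mx 0 i != 0 :> 'rV[K]_n.
  by apply/eqP => /matrixP /(_ 0 i); rewrite !mxE !eqxx => /eqP; rewrite oner_eq0.
have Si : 0 < S i i.
  by have := posS.2 _ delta_nz; rewrite /qform -rowE trmx_delta -colE [X in 0 < X]mxE mxE.
have BE : (block_mx a v w B : 'M_(1 + n)) (lift ord0 i) (lift ord0 i) = B i i.
  by rewrite Ei; apply: block_mxEdr.
rewrite BE.
rewrite ltW //= !mxE lerBlDr lerDl mulr_ge0 ?invr_ge0 ?(ltW k0) // big_ord1.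
(* By symmetry the diagonal entry subtracted in [S] is a square over [k]. *)
have -> : v 0 i = w i 0 by rewrite -vw mxE.

exact: sqr_ge0.
Qed.

(** * Ridge regression *)

Section Ridge.
Variables (R : realType) (d : nat).
Implicit Types (s : seq ('rV[R]_d * bool)) (x v theta : 'rV[R]_d) (y : bool).

Definition dot x v : R := (x *m v^T) 0 0.

Lemma dotE x v : dot x v = \sum_i x 0 i * v 0 i.
Proof. by rewrite /dot mxE; apply: eq_bigr => i _; rewrite mxE. Qed.

Lemma dotC x v : dot x v = dot v x.
Proof. by rewrite !dotE; apply: eq_bigr => i _; rewrite mulrC. Qed.

Lemma dotDl x1 x2 v : dot (x1 + x2) v = dot x1 v + dot x2 v.
Proof. by rewrite /dot mulmxDl mxE. Qed.

Lemma dotZl c x v : dot (c *: x) v = c * dot x v.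
Proof. by rewrite /dot -scalemxAl mxE. Qed.

Lemma dotM (A : 'M_d) x v : dot (x *m A) v = dot x (v *m A^T).
Proof. by rewrite /dot trmx_mul trmxK mulmxA. Qed.

Lemma outerM x v : v *m (x^T *m x) = dot v x *: x.
Proof. by rewrite mulmxA [v *m _]mx11_scalar mul_scalar_mx. Qed.

Lemma qformE (A : 'M_d) v : qform A v = dot (v *m A) v.
Proof. by []. Qed.

Lemma qform_outer x v : qform (x^T *m x) v = dot v x ^+ 2.
Proof. by rewrite qformE outerM dotZl [dot x v]dotC. Qed.

Lemma qformDl (A B : 'M_d) v : qform (A + B) v = qform A v + qform B v.
Proof. by rewrite /qform mulmxDr mulmxDl mxE. Qed.

Lemma qformZl c (A : 'M_d) v : qform (c *: A) v = c * qform A v.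
Proof. by rewrite /qform -scalemxAr -scalemxAl mxE. Qed.

Lemma qform1 v : qform 1%:M v = \sum_i v 0 i ^+ 2.
Proof. by rewrite /qform mulmx1 mxE; apply: eq_bigr => i _; rewrite mxE. Qed.

Lemma qform_outer_update (A : 'M_d) x v c : A^T = A ->
  qform A (v + c *: x) = qform A v + 2 * c * dot (x *m A) v + c ^+ 2 * qform A x.
Proof.
move=> sA; rewrite !qformE mulmxDl -scalemxAl !dotDl !dotZl.
rewrite ![dot _ (v + _)]dotC !dotDl !dotZl !(dotC _ (_ *m A)).
have -> : dot (v *m A) x = dot (x *m A) v by rewrite dotM sA dotC.
by ring.
Qed.

(** The identity term encodes the ridge penalty |theta|^2 and makes the matrix invertible for every
    data set. *)
Definition gram s : 'M[R]_d := 1%:M + \sum_(z <- s) z.1^T *m z.1.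

Definition moment s : 'rV[R]_d := \sum_(z <- s) z.2%:R *: z.1.

Lemma gram_rcons s x y : gram (rcons s (x, y)) = gram s + x^T *m x.
Proof. by rewrite /gram big_rcons addrA. Qed.

Lemma moment_rcons s x y : moment (rcons s (x, y)) = moment s + y%:R *: x.
Proof. by rewrite /moment big_rcons. Qed.

Lemma gram_sym s : (gram s)^T = gram s.
Proof.
elim/last_ind: s => [|s [x y] IH]; first by rewrite /gram big_nil addr0 trmx1.
by rewrite gram_rcons linearD /= IH trmx_mul trmxK.
Qed.

Lemma qform_gram_ge s v : \sum_i v 0 i ^+ 2 <= qform (gram s) v.
Proof.
elim/last_ind: s => [|s [x y] IH]; first by rewrite /gram big_nil addr0 qform1.
by rewrite gram_rcons qformDl qform_outer ler_wpDr ?sqr_ge0.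
Qed.

Lemma gram_posdef s : posdef (gram s).
Proof.
split=> [|v]; first exact: gram_sym.
move/rV0Pn => [i vi]; apply: lt_le_trans (qform_gram_ge s v).
rewrite (bigD1 i) //= ltr_pwDl ?sumr_ge0 // => [|j _]; last exact: sqr_ge0.
by rewrite exprn_even_gt0.
Qed.

Lemma gram_unit s : gram s \in unitmx.
Proof.
by have /andP[det_gt0 _] := posdef_det (gram_posdef s); rewrite unitmxE unitfE gt_eqF.
Qed.

Definition cov s : 'M[R]_d := invmx (gram s).

Lemma cov_sym s : (cov s)^T = cov s.
Proof. by rewrite /cov trmx_inv gram_sym. Qed.

Lemma gramK s v : v *m cov s *m gram s = v.
Proof. by rewrite mulmxKV ?gram_unit. Qed.

Lemma qform_cov_ge0 s v : 0 <= qform (cov s) v.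
Proof.
have -> : qform (cov s) v = qform (gram s) (v *m cov s).
  by rewrite !qformE gramK dotM cov_sym.
by apply: le_trans (qform_gram_ge _ _); apply: sumr_ge0 => i _; apply: sqr_ge0.
Qed.

(** Sherman-Morrison formula, checked by multiplying with the new Gram matrix. It is the update rule
    that [cov_cell] executes. *)
Lemma cov_rcons s x y (u := x *m cov s) :
  cov (rcons s (x, y)) = cov s - (1 + dot u x)^-1 *: (u^T *m u).
Proof.
have s0 : 0 <= dot u x by exact: (qform_cov_ge0 s x).
have s1 : 1 + dot u x != 0 by rewrite gt_eqF // ltr_pwDl.
have Gu : gram s *m u^T = x^T.
  by rewrite -[gram s]gram_sym -trmx_mul gramK.
have xu : x *m u^T = (dot u x)%:M by rewrite dotC -mx11_scalar.
suff E : gram (rcons s (x, y)) *m (cov s - (1 + dot u x)^-1 *: (u^T *m u)) = 1%:M.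
  by rewrite -[RHS](mulKmx (gram_unit (rcons s (x, y)))) E mulmx1.
rewrite gram_rcons mulmxDl !mulmxBr mulmxV ?gram_unit // -!scalemxAr mulmxA Gu.
rewrite -[x^T *m x *m cov s]mulmxA -/u.
have -> : x^T *m x *m (u^T *m u) = dot u x *: (x^T *m u).
  by rewrite -mulmxA [x *m _]mulmxA xu mul_scalar_mx -scalemxAr.
rewrite -addrA addrC -[RHS]add0r; congr (_ + _).
rewrite scalerA -scaleNr -[in X in _ + X]scaleNr -{2}[x^T *m u]scale1r -!scalerDl.
suff -> : - (1 + dot u x)^-1 + (1 - (1 + dot u x)^-1 * dot u x) = 0 by rewrite scale0r.
by field.
Qed.

Lemma det_gram_rcons s x y :
  \det (gram (rcons s (x, y))) = \det (gram s) * (1 + dot (x *m cov s) x).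
Proof.
rewrite gram_rcons.
have -> : gram s + x^T *m x = gram s *m (1%:M + (cov s *m x^T) *m x).
  by rewrite mulmxDr mulmx1 !mulmxA mulmxV ?gram_unit // mul1mx.
by rewrite det_mulmx det_1mulmx mulmxA.
Qed.

(** Hadamard's inequality reduces the determinant to the diagonal, where each entry is at most 1 +
    n. *)
Lemma ln_det_gram_le s n : (size s <= n)%N ->
  (forall z, z \in s -> forall i, z.1 0 i ^+ 2 <= 1) ->
  ln (\det (gram s)) <= d%:R * ln (1 + n%:R).
Proof.
move=> sn s1; have /andP[det0 detle] := posdef_det (gram_posdef s).
have n0 : 0 < 1 + n%:R :> R by rewrite ltr_pwDl.
rewrite mulr_natl -lnXn // ler_ln ?posrE ?exprn_gt0 //.
apply: le_trans detle _; have -> : (1 + n%:R) ^+ d = \prod_(i < d) (1 + n%:R) :> R.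
  by rewrite prodr_const card_ord.
apply: ler_prod => i _; have diag : gram s i i = 1 + \sum_(z <- s) z.1 0 i ^+ 2.
  rewrite /gram !mxE eqxx summxE; congr (_ + _); apply: eq_bigr => z _.
  by rewrite mxE big_ord1 mxE.
rewrite diag addr_ge0 ?sumr_ge0 //= => [|z _]; last exact: sqr_ge0.
rewrite lerD2l (le_trans (y := (size s)%:R)) ?ler_nat //.
rewrite -sum1_size natr_sum big_seq [leRHS]big_seq.
by apply: ler_sum => z zs; apply: s1.
Qed.

(** Nested tests rather than min and max, to match the branches of [gap_code]. *)
Definition clip (r : R) : R := if r <= 0 then 0 else if 1 <= r then 1 else r.

Lemma clip_itv r : 0 <= clip r <= 1.
Proof. by rewrite /clip; case: ifPn; [lra | case: ifPn; lra]. Qed.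

Lemma clip_le r y : (clip r - y%:R) ^+ 2 <= (r - y%:R) ^+ 2.
Proof.
rewrite /clip; case: y; rewrite ?mulr1n ?mulr0n.
  by case: ifPn => [|?]; [nra | case: ifPn => ?; nra].
by case: ifPn => [|?]; [nra | case: ifPn => ?; nra].
Qed.

(* By Sherman-Morrison, dividing by [1 + dot (x *m cov s) x] amounts to using the
   covariance updated with the current context. *)
Definition vaw s x : R :=
  clip (dot (x *m cov s) (moment s) / (1 + dot (x *m cov s) x)).

(* The regularised loss of [theta] on [s], minus its minimum over all vectors. *)
Definition slack theta s : R :=
  qform (gram s) theta - 2 * dot theta (moment s) + qform (cov s) (moment s).

(** Completing the square: the slack is the Gram form at the difference between [theta] and the
    ridge solution [moment s *m cov s]. *)
Lemma slack_ge0 theta s : 0 <= slack theta s.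
Proof.
have -> : slack theta s = qform (gram s) (theta + (-1) *: (moment s *m cov s)).
  rewrite qform_outer_update ?gram_sym // gramK /slack dotC.
  have -> : qform (gram s) (moment s *m cov s) = qform (cov s) (moment s).
    by rewrite !qformE gramK dotM cov_sym.
  by ring.
by apply: le_trans (qform_gram_ge _ _); apply: sumr_ge0 => i _; apply: sqr_ge0.
Qed.

(** Its increase in a round pays for the forecaster's regret to [theta] in that round, so total
    regret telescopes. It starts at -|theta|^2, and the nonnegative slack leaves at most the
    log-determinant at the end. *)
Definition potential theta s : R := ln (\det (gram s)) - slack theta s.

Lemma potential_nil theta : potential theta [::] = - \sum_i theta 0 i ^+ 2.
Proof.
rewrite /potential /slack /cov /moment /gram !big_nil addr0 det1 ln1 invmx1.
by rewrite /qform !mul0mx -/(qform _ _) qform1 /dot trmx0 mulmx0 mxE; ring.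
Qed.

(** The change of slack is computed exactly by Sherman-Morrison; what remains is at most sg / (1 +
    sg), which the increase ln (1 + sg) of the log-determinant covers. *)
Lemma vaw_step theta s x y :
  (vaw s x - y%:R) ^+ 2 - (dot theta x - y%:R) ^+ 2 <=
  potential theta (rcons s (x, y)) - potential theta s.
Proof.
have det0 := proj1 (andP (posdef_det (gram_posdef s))).
rewrite /potential det_gram_rcons /slack gram_rcons moment_rcons cov_rcons.
set u := x *m cov s; set sg := dot u x; set r := dot u (moment s).
have sg0 : 0 <= sg := qform_cov_ge0 s x.
have sg1 : 1 + sg != 0 by rewrite gt_eqF // ltr_pwDl.
(* From ln (1 + z) <= z at z = - sg / (1 + sg), where 1 + z = 1 / (1 + sg). *)
have lnge : sg / (1 + sg) <= ln (1 + sg).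
  have := @le_ln1Dx R (- (sg / (1 + sg))).
  have -> : 1 + - (sg / (1 + sg)) = (1 + sg)^-1 by field.
  rewrite lnV ?posrE ?ltr_pwDl // ltrN2 ltr_pdivrMr ?ltr_pwDl // => /(_ _); lra.
rewrite lnM ?posrE ?ltr_pwDl //.
rewrite -scaleNr !qformDl qformZl qform_outer.
rewrite !qform_outer (qform_outer_update _ _ _ (cov_sym s)) -/u -/r.
rewrite (_ : qform (cov s) x = sg) //.
rewrite ![dot _ (moment s + _)]dotC !dotDl !dotZl ![dot _ u]dotC ![dot x _]dotC.
rewrite [dot (moment s) theta]dotC -/r -/sg.
apply: le_trans (_ : (r / (1 + sg) - y%:R) ^+ 2 - (dot theta x - y%:R) ^+ 2 <= _).
  by rewrite lerD2r /vaw clip_le.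
set t := dot theta x; set Q := qform _ _; set Q' := qform _ _.
set dt := ln (\det _); set dm := dot theta _; set V := qform _ _.
have extra0 : 0 <= (r / (1 + sg)) ^+ 2 * sg by rewrite mulr_ge0 ?sqr_ge0.
have y1 : (y%:R : R) ^+ 2 <= 1 by case: (y); rewrite ?mulr0n ?expr0n ?expr1n.
have ysg : y%:R ^+ 2 * (sg / (1 + sg)) <= sg / (1 + sg).
  by rewrite ler_piMl // divr_ge0 // addr_ge0.
(* The last bracket is the increase of the slack. The negative square is dropped, and the first term
   is covered by the log-determinant since y^2 <= 1. *)
have -> : (r / (1 + sg) - y%:R) ^+ 2 - (t - y%:R) ^+ 2 =
    y%:R ^+ 2 * (sg / (1 + sg)) - (r / (1 + sg)) ^+ 2 * sg
    - (t ^+ 2 - 2 * y%:R * t + (2 * y%:R * r + y%:R ^+ 2 * sg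
       - (1 + sg)^-1 * (r + y%:R * sg) ^+ 2)) by field.
by move: extra0 ysg lnge; lra.
Qed.

Lemma potential_le theta s n : (size s <= n)%N ->
  (forall z, z \in s -> forall i, z.1 0 i ^+ 2 <= 1) ->
  potential theta s <= d%:R * ln (1 + n%:R).
Proof.
move=> sn s1; apply: le_trans (ln_det_gram_le sn s1).
by rewrite /potential lerBlDr lerDl slack_ge0.
Qed.

End Ridge.

(** * Hedging between neighbouring grid points *)

(** Let a be the norm of [theta] without its first coordinate. Contexts whose remaining coordinates
    have norm 1/2 along plus or minus that part of [theta] give |theta_1| + a <= 4, hence |theta|^2
    <= 16. *)
Lemma Flin4_dot (R : realType) d (f : context R d -> R) : (0 < d)%N -> Flin4 f ->
  exists theta : 'rV[R]_d, (forall v, f v = dot theta v) /\ \sum_i theta 0 i ^+ 2 <= 16.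
Proof.
move=> d0 [[theta fE] f4]; exists theta; split=> [v|]; first by rewrite dotE.
pose i0 : 'I_d := Ordinal d0.
pose B := \sum_(i | i != i0) theta 0 i ^+ 2; pose a := Num.sqrt B.
have B0 : 0 <= B by apply: sumr_ge0 => i _; apply: sqr_ge0.
have a0 : 0 <= a by apply: sqrtr_ge0.
have aB : B = a ^+ 2 by rewrite sqr_sqrtr.
(* The sign e is 1 or -1. If a = 0, division by zero makes the tail of [v] zero, and the formula
   still holds. *)
have test e : e ^+ 2 = 1 -> (theta 0 i0 / 2 + e * (a / 2)) ^+ 2 <= 4.
  move=> e1; pose v : context R d :=
    \row_i if i == i0 then 2^-1 else e * (theta 0 i / (2 * a)).
  have cv : contexts v.
    split; last by move=> i i00; rewrite mxE (_ : i = i0) ?eqxx //; apply: val_inj.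
    rewrite /l2norm -[leRHS]sqrtr1 ler_sqrt // (bigD1 i0) //= mxE eqxx.
    under eq_bigr => i /negPf ii do rewrite mxE ii !exprMn e1 mul1r exprVn.
    rewrite -mulr_suml -/B aB exprMn invfM mulrCA.
    have [->|an] := eqVneq a 0; first by rewrite expr0n /= mul0r mulr0; lra.
    by rewrite mulfV ?sqrf_eq0 //; lra.
  suff <- : f v = theta 0 i0 / 2 + e * (a / 2) by apply: f4.
  rewrite fE (bigD1 i0) //= mxE eqxx; congr (_ + _).
  under eq_bigr => i /negPf ii do rewrite mxE ii mulrCA [theta _ _ * (theta _ _ * _)]mulrA -expr2.
  rewrite -mulr_sumr -mulr_suml -/B aB; congr (e * _).
  have [->|an] := eqVneq a 0; first by rewrite expr0n /= !mul0r.
  by field.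
have t1 := test 1 (expr1n _ _); have t2 := test (-1) (sqrr_sign _ 1).
rewrite (bigD1 i0) //= -/B aB; move: t1; rewrite mul1r => t1.
rewrite mulN1r in t2.
nra.
Qed.

(** The weights make the mean of w_p - p zero, which removes the dependence on y. Strictness at [j]
    keeps the denominator positive; [q] is written as [output_code] computes it. *)
Lemma hedge_two (R : realType) N (i j : 'I_N.+1) (w q : 'I_N.+1 -> R) :
  (0 < N)%N -> j = i.+1 :> nat -> grid R i <= w i -> w j < grid R j ->
  q =1 (fun k => if k == i then (grid R j - w j) / ((w i - grid R i) - (w j - grid R j))
        else if k == j then (w i - grid R i) / ((w i - grid R i) - (w j - grid R j)) else 0) ->
  is_distribution q /\
  forall y : bool, \sum_k q k * ((grid R k - y%:R) ^+ 2 - (w k - y%:R) ^+ 2)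
                   <= (4 * N%:R ^+ 2)^-1.
Proof.
move=> N0 ji gi gj qE.
have n0 : 0 < N%:R :> R by rewrite ltr0n.
have jni : (j == i) = false by apply/eqP => /(congr1 val) /=; lia.
have qi := qE i; have qj := qE j; rewrite eqxx in qi; rewrite jni eqxx in qj.
have sumE F : \sum_k q k * F k = q i * F i + q j * F j.
  rewrite (bigD1 i) //= (bigD1 j) ?jni //= big1 ?addr0 // => k /andP[/negPf ki /negPf kj].
  by rewrite qE ki kj mul0r.
have gE : grid R j = grid R i + N%:R^-1.
  by rewrite /grid ji -natr1 mulrDl div1r.
set a := w i - grid R i in qi qj; set b := grid R j - w j in qi.
have bE : a - (w j - grid R j) = a + b by rewrite /b; ring.
rewrite bE in qi qj.
have a0 : 0 <= a by rewrite /a; lra.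
have b0 : 0 < b by rewrite /b; lra.
have qE' := qE; rewrite -/a -/b bE in qE'.
have wi : w i = grid R i + a by rewrite /a; ring.
have wj : w j = grid R i + N%:R^-1 - b by rewrite /b gE; ring.
have b0' := ltW b0; clearbody a b.
have ab : a + b != 0 by rewrite gt_eqF // ltr_wpDl.
split.
  split=> [k|].
    by rewrite qE'; case: ifP => _; last case: ifP => _ //; rewrite divr_ge0 // addr_ge0.
  have := sumE (fun=> 1); under eq_bigr do rewrite mulr1.
  by move=> ->; rewrite qi qj; field.
move=> y; rewrite sumE qi qj.
rewrite wi wj gE; set g := grid R i; set m := N%:R^-1.
(* With c the midpoint of the two grid points, the y-dependence cancels and the
   excess is the average of 2 (w - p) (c - p) - (w - p)^2 <= (p - c)^2. *)
have -> : (4 * N%:R ^+ 2)^-1 = (m / 2) ^+ 2.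
  by rewrite /m; field; rewrite gt_eqF.
set z := y%:R.
have -> : b / (a + b) * ((g - z) ^+ 2 - (g + a - z) ^+ 2) +
   a / (a + b) * ((g + m - z) ^+ 2 - (g + m - b - z) ^+ 2) =
   (m / 2) ^+ 2 - (b / (a + b) * (a - m / 2) ^+ 2 + a / (a + b) * (b - m / 2) ^+ 2) +
   (b * (m * a - a ^+2) + a * (m * b - b ^+ 2) - b * (m * a - a ^+2) - a * (m * b - b ^+ 2)).
  by field.
rewrite [X in _ + X](_ : _ = 0) ?addr0; last by ring.
by rewrite lerBlDr lerDl; apply: addr_ge0; apply: mulr_ge0; rewrite ?sqr_ge0 ?divr_ge0 ?addr_ge0.
Qed.

(** Covers the case without a crossing: the top grid point is 1 and its expert also predicts 1, so
    drawing it has zero excess. *)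
Lemma hedge_one (R : realType) N (i : 'I_N.+1) (w q : 'I_N.+1 -> R) :
  w i = grid R i -> q =1 (fun k => (k == i)%:R) ->
  is_distribution q /\
  forall y : bool, \sum_k q k * ((grid R k - y%:R) ^+ 2 - (w k - y%:R) ^+ 2)
                   <= (4 * N%:R ^+ 2)^-1.
Proof.
move=> wi qE.
have sumE F : \sum_k q k * F k = F i.
  rewrite (bigD1 i) //= qE eqxx mul1r big1 ?addr0 // => k /negPf ki.
  by rewrite qE ki mul0r.
split=> [|y]; last by rewrite sumE wi subrr invr_ge0 mulr_ge0 ?exprn_ge0.
split=> [k|]; first by rewrite qE.
have := sumE (fun=> 1); under eq_bigr do rewrite mulr1.
by [].
Qed.

(** * Sequences of draws and supermartingales *)

Definition draw_cons N n (k : 'I_N.+1) (g : draws N n) : draws N n.+1 :=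
  [ffun t => oapp g k (unlift ord0 t)].

Lemma sum_draws_cons (R : realType) N n (F : draws N n.+1 -> R) :
  \sum_w F w = \sum_k \sum_g F (draw_cons k g).
Proof.
rewrite pair_big /= (reindex (fun p : 'I_N.+1 * draws N n => draw_cons p.1 p.2)) //=.
exists (fun w => (w ord0, [ffun s => w (lift ord0 s)])) => [[k g]|w] _ /=.
  rewrite ffunE unlift_none; congr pair; apply/ffunP => s.
  by rewrite !ffunE liftK.
by apply/ffunP => t; rewrite ffunE; case: unliftP => [s|] -> //=; rewrite ffunE.
Qed.

Section Supermartingale.
Variables (R : realType) (d N : nat).
Implicit Types (A : forecaster R d N) (Phi : seq (round R d N) -> R).

Lemma transcript_cons n (x : 'I_n.+1 -> context R d) y (k : 'I_N.+1) g :
  transcript x y (draw_cons k g) = (x ord0, k, y ord0) ::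
    transcript (fun t => x (lift ord0 t)) (fun t => y (lift ord0 t)) g.
Proof.
rewrite /transcript enum_ordSl /= ffunE unlift_none /= -map_comp; congr cons.
by apply: eq_map => t /=; rewrite ffunE liftK.
Qed.

Lemma draws_mass_cons A n (x : 'I_n.+1 -> context R d) y k g :
  draws_mass A x y (draw_cons k g) = A [::] (x ord0) k *
    draws_mass (fun h => A ((x ord0, k, y ord0) :: h))
      (fun t => x (lift ord0 t)) (fun t => y (lift ord0 t)) g.
Proof.
rewrite /draws_mass big_ord_recl /chosen_dist /= take0 ffunE unlift_none.
congr (_ * _); apply: eq_bigr => t _.
by rewrite transcript_cons /= ffunE liftK.
Qed.

(** Induction peels off the first round: conditionally on it, the rest is the same protocol with [A]
    and [Phi] shifted by that round. The hypotheses range over all histories so as to survive the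
    shift. *)
Lemma Ex_supermartingale A Phi T (x : 'I_T -> context R d) y :
  (forall h v k, 0 <= A h v k) ->
  (forall h v b, \sum_k A h v k * Phi (rcons h (v, k, b)) <= Phi h) ->
  Ex A x y (fun w => Phi (transcript x y w)) <= Phi [::].
Proof.
elim: T A Phi x y => [|T IH] A Phi x y A0 step; rewrite /Ex.
  rewrite (eq_bigr (fun=> Phi [::])) => [|w _].
    by rewrite sumr_const card_ffun !card_ord expn0 mulr1n.
  by rewrite /draws_mass big_ord0 mul1r /transcript enum_ord0.
rewrite sum_draws_cons; apply: le_trans (step [::] (x ord0) (y ord0)).
apply: ler_sum => k _.
under eq_bigr => g _ do rewrite draws_mass_cons transcript_cons -mulrA.
rewrite -mulr_sumr ler_wpM2l //.
apply: (IH _ (fun h => Phi ((x ord0, k, y ord0) :: h))) => [h v k'|h v b].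
  exact: A0.
exact: (step (_ :: h)).
Qed.

End Supermartingale.

(** * Swap regret of the forecaster *)

(** Since exp (-x) >= 1 - x, exp x * (1 - x) <= 1, whereas (1 + x + 2 x^2)(1 - x) = 1 + x^2 (1 - 2
    x) >= 1. *)
Lemma expR_le_quadratic (R : realType) (x : R) : x <= 2^-1 -> expR x <= 1 + x + 2 * x ^+ 2.
Proof.
move=> x1.
have e0 := expR_gt0 x; have e1 := expR_ge1Dx (- x); have e2 := expRxMexpNx_1 x.
suff : (1 + x + 2 * x ^+ 2) * (1 - x) >= expR x * (1 - x) by rewrite ler_pM2r //; lra.
have : expR x * (1 - x) <= 1 by rewrite -[leRHS]e2 ler_pM2l.
by nra.
Qed.

Section ProbabilitySpace.
Variables (R : realType) (d N T : nat) (A : forecaster R d N).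
Variables (x : 'I_T -> context R d) (y : 'I_T -> bool).
Hypothesis A_dist : forall h v, is_distribution (A h v).

Lemma draws_mass_ge0 w : 0 <= draws_mass A x y w.
Proof. by apply: prodr_ge0 => t _; apply: (A_dist _ _).1. Qed.

(** Total mass one, obtained by viewing the constants c and -c as supermartingales. *)
Lemma Ex_cst (c : R) : Ex A x y (fun=> c) = c.
Proof.
apply/eqP; rewrite eq_le; apply/andP; split.
  apply: (Ex_supermartingale (Phi := fun=> c)) => [h v|h v b]; first exact: (A_dist _ _).1.
  by rewrite -mulr_suml (A_dist _ _).2 mul1r.
rewrite -[leRHS]opprK lerNr -sumrN.
under eq_bigr do rewrite -mulrN.
apply: (Ex_supermartingale (Phi := fun=> - c)) => [h v|h v b]; first exact: (A_dist _ _).1.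
by rewrite -mulr_suml (A_dist _ _).2 mul1r.
Qed.

Lemma Ex_le (Y Z : draws N T -> R) : (forall w, Y w <= Z w) -> Ex A x y Y <= Ex A x y Z.
Proof. by move=> YZ; apply: ler_sum => w _; rewrite ler_wpM2l ?draws_mass_ge0. Qed.

Lemma ExD (Y Z : draws N T -> R) :
  Ex A x y (fun w => Y w + Z w) = Ex A x y Y + Ex A x y Z.
Proof. by rewrite /Ex -big_split; apply: eq_bigr => w _; rewrite mulrDr. Qed.

Lemma PrE (E : pred (draws N T)) : Pr A x y E = Ex A x y (fun w => (E w)%:R).
Proof.
rewrite /Pr big_mkcond; apply: eq_bigr => w _.
by case: (E w); rewrite (mulr1, mulr0).
Qed.

Lemma Pr_le (E F : pred (draws N T)) : (forall w, E w -> F w) -> Pr A x y E <= Pr A x y F.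
Proof.
move=> EF; rewrite !PrE; apply: Ex_le => w.
by case: (boolP (E w)) => [/EF ->|_]; rewrite ?lexx ?ler0n.
Qed.

Lemma Pr_ge_of_compl (E F : pred (draws N T)) (delta : R) :
  (forall w, ~~ F w -> E w) -> Pr A x y F <= delta -> 1 - delta <= Pr A x y E.
Proof.
move=> FE Fd; suff : 1 <= Pr A x y E + Pr A x y F by lra.
rewrite !PrE -ExD -[leLHS](Ex_cst 1); apply: Ex_le => w.
by case: (boolP (F w)) => Fw; [rewrite lerDr | rewrite FE // lerDl].
Qed.

End ProbabilitySpace.

Section Calibeating.
Variables (R : realType) (d N : nat).
Implicit Types (h : seq (round R d N)) (v : context R d) (k : 'I_N.+1) (b : bool).

Definition data k h : seq ('rV[R]_d * bool) :=
  [seq (r.1.1, r.2) | r <- h & r.1.2 == k].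

Lemma data_rcons k h v k' b :
  data k (rcons h (v, k', b)) = if k' == k then rcons (data k h) (v, b) else data k h.
Proof. by rewrite /data filter_rcons /=; case: ifP => _ //; rewrite map_rcons. Qed.

Definition expert h v k : R := vaw (data k h) v.

Definition gain h v k b : R := (grid R k - b%:R) ^+ 2 - (expert h v k - b%:R) ^+ 2.

(** The prefix [pre] carries the rounds already played, because the expert's prediction in a round
    depends on them. *)
Fixpoint excess_from pre h : R :=
  if h is r :: h' then gain pre r.1.1 r.1.2 r.2 + excess_from (rcons pre r) h' else 0.

Definition excess h : R := excess_from [::] h.

Lemma excess_rcons h v k b : excess (rcons h (v, k, b)) = excess h + gain h v k b.
Proof.
(* Exposes the empty prefix so that the induction can generalise over it. *)
rewrite /excess -[in gain h]/([::] ++ h); elim: h [::] => [|r h IH] pre /=.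
  by rewrite cats0 addrC.
by rewrite IH addrA cat_rcons.
Qed.

Lemma grid_itv k : 0 <= grid R k <= 1.
Proof.
rewrite /grid; have [->|N0] := eqVneq (N%:R : R) 0; first by rewrite invr0 mulr0 ler01 lexx.
by rewrite divr_ge0 //= ler_pdivrMr ?lt0r ?N0 ?ler0n // mul1r ler_nat -ltnS.
Qed.

Lemma sqr_sub_bool_itv (t : R) b : 0 <= t <= 1 -> 0 <= (t - b%:R) ^+ 2 <= 1.
Proof. by case: b; rewrite ?mulr1n ?mulr0n => t01; apply/andP; split; nra. Qed.

Lemma gain_itv h v k b : -1 <= gain h v k b <= 1.
Proof.
have := sqr_sub_bool_itv b (grid_itv k).
by have := sqr_sub_bool_itv b (clip_itv _ : 0 <= expert h v k <= 1); rewrite /gain; lra.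
Qed.

Lemma excess_le_size h : excess h <= (size h)%:R.
Proof.
elim/last_ind: h => [|h [[v k] b] IH]; first by rewrite /excess.
rewrite excess_rcons size_rcons -natr1; have := gain_itv h v k b; lra.
Qed.

(** A round changes the data of the drawn grid point only, so [vaw_step] for that point pays for it
    and the other potentials stay put. The bound is pathwise and uniform in [theta]. *)
Lemma swap_regret_decomp (theta : 'I_N.+1 -> 'rV[R]_d) h :
  \sum_(r <- h) ((grid R r.1.2 - r.2%:R) ^+ 2 - (dot (theta r.1.2) r.1.1 - r.2%:R) ^+ 2)
  <= excess h + \sum_k (potential (theta k) (data k h) - potential (theta k) [::]).
Proof.
elim/last_ind: h => [|h [[v k] b] IH].
  by rewrite big_nil /excess add0r big1 // => k _; rewrite subrr.
rewrite big_rcons excess_rcons /=.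
have -> : \sum_k0 (potential (theta k0) (data k0 (rcons h (v, k, b))) - potential (theta k0) [::])
  = \sum_k0 (potential (theta k0) (data k0 h) - potential (theta k0) [::])
    + (potential (theta k) (rcons (data k h) (v, b)) - potential (theta k) (data k h)).
  rewrite (bigD1 k) //= [in RHS](bigD1 k) //= data_rcons eqxx.
  under eq_bigr => k' /negPf kk do rewrite data_rcons eq_sym kk.
  by ring.
by have := vaw_step (theta k) (data k h) v b; rewrite -/(expert h v k) /gain; lra.
Qed.

Variables (A : forecaster R d N) (eps : R).
Hypotheses (d_gt0 : (0 < d)%N) (eps_ge0 : 0 <= eps).
Hypothesis A_dist : forall h v, is_distribution (A h v).
Hypothesis A_hedge : forall h v b, \sum_k A h v k * gain h v k b <= eps.
Variables (T : nat) (x : 'I_T -> context R d) (y : 'I_T -> bool).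
Hypothesis xX : forall t, contexts (x t).

Lemma size_transcript (w : draws N T) : size (transcript x y w) = T.
Proof. by rewrite size_map size_enum_ord. Qed.

Lemma contexts_coord v i : contexts v -> v 0 i ^+ 2 <= 1.
Proof.
case=> + _; rewrite /l2norm -[leRHS]sqrtr1 ler_sqrt // (bigD1 i) //=.
by apply: le_trans; rewrite lerDl sumr_ge0 // => j _; apply: sqr_ge0.
Qed.

Lemma SReg_le_of (w : draws N T) (c : R) :
  (forall f : 'I_N.+1 -> context R d -> R, (forall k, Flin4 (f k)) ->
    \sum_t ((grid R (w t) - (y t)%:R) ^+ 2 - (f (w t) (x t) - (y t)%:R) ^+ 2) <= c) ->
  SReg x y (@Flin4 R d) w <= c.
Proof.
move=> H; apply: ge_sup => [|_ [f /= ff] <-]; last exact: H.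
(* The supremum needs a nonempty set; the zero functions supply an element. *)
exists (\sum_t ((grid R (w t) - (y t)%:R) ^+ 2 - (0 - (y t)%:R) ^+ 2)).
exists (fun _ _ => 0) => //= k; split; last by move=> v _; rewrite expr0n.
by exists 0 => v; rewrite big1 // => i _; rewrite mxE mul0r.
Qed.

Lemma SReg_le_T (w : draws N T) : SReg x y (@Flin4 R d) w <= T%:R.
Proof.
apply: SReg_le_of => f _; rewrite -[T in leRHS]card_ord -sum1_card natr_sum.
apply: ler_sum => t _; have := sqr_sub_bool_itv (y t) (grid_itv (w t)).
by have := sqr_ge0 (f (w t) (x t) - (y t)%:R); lra.
Qed.

(** Each of the N + 1 experts costs at most 16, from |theta|^2 in the initial potential, plus its
    log-determinant. *)
Lemma SReg_le_excess (w : draws N T) : SReg x y (@Flin4 R d) w <=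
  excess (transcript x y w) + N.+1%:R * (16 + d%:R * ln (1 + T%:R)).
Proof.
apply: SReg_le_of => f ff.
have [theta thP] := choice (fun k => Flin4_dot d_gt0 (ff k)).
have := swap_regret_decomp theta (transcript x y w).
rewrite /transcript big_map big_enum /=.
under eq_bigr => t _ do rewrite -(thP _).1.
move/le_trans; apply; rewrite lerD2l.
have -> : N.+1%:R * (16 + d%:R * ln (1 + T%:R)) =
    \sum_(k < N.+1) (16 + d%:R * ln (1 + T%:R)) :> R.
  by rewrite sumr_const card_ord mulr_natl.
apply: ler_sum => k _; rewrite potential_nil opprK addrC; apply: lerD.
  exact: (thP k).2.
apply: potential_le => [|z].
  by rewrite /data size_map size_filter (leq_trans (count_size _ _)) ?size_transcript.
case/mapP => r; rewrite mem_filter => /andP[_ /mapP[t _ ->]] -> i /=.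
exact: contexts_coord.
Qed.

(** The excess minus [eps] per completed round is a supermartingale started at 0. *)
Lemma Ex_SReg : Ex A x y (SReg x y (@Flin4 R d)) <=
  N.+1%:R * (16 + d%:R * ln (1 + T%:R)) + T%:R * eps.
Proof.
set c := _ * _ + _.
pose Phi h := excess h - (size h)%:R * eps.
apply: le_trans (_ : Ex A x y (fun w => Phi (transcript x y w) + c) <= _).
  apply: Ex_le => // w; rewrite /Phi size_transcript /c.
  by have := SReg_le_excess w; lra.
rewrite ExD Ex_cst // gerDr.
have -> : 0 = Phi [::] by rewrite /Phi /excess /= mul0r subrr.
apply: Ex_supermartingale => [h v|h v b]; first exact: (A_dist _ _).1.
have -> : \sum_k A h v k * Phi (rcons h (v, k, b)) =
    (\sum_k A h v k) * (Phi h - eps) + \sum_k A h v k * gain h v k b.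
  rewrite mulr_suml -big_split; apply: eq_bigr => k _ /=.
  by rewrite /Phi excess_rcons size_rcons -natr1; ring.
by rewrite (A_dist h v).2 mul1r; have := A_hedge h v b; lra.
Qed.

(** As gains lie in [-1, 1] and l <= 1/2, the quadratic bound on exp gives a conditional factor of
    at most 1 + l eps + 2 l^2 <= exp a per round. *)
Lemma Ex_expR_excess (l : R) : 0 <= l <= 2^-1 ->
  Ex A x y (fun w => expR (l * excess (transcript x y w))) <=
  expR (T%:R * (l * eps + 2 * l ^+ 2)).
Proof.
move=> /andP[l0 l1]; set a := l * eps + _.
pose Phi h := expR (l * excess h - (size h)%:R * a).
have -> : (fun w => expR (l * excess (transcript x y w))) =
    (fun w : draws N T => expR (T%:R * a) * Phi (transcript x y w)).
  by apply/funext => w; rewrite /Phi size_transcript -expRD; congr expR; ring.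
rewrite /Ex; under eq_bigr do rewrite mulrCA.
rewrite -mulr_sumr ler_piMr ?expR_ge0 //.
have -> : 1 = Phi [::] by rewrite /Phi /excess /= mul0r mulr0 subrr expR0.
apply: Ex_supermartingale => [h v|h v b]; first exact: (A_dist _ _).1.
have step k : A h v k * Phi (rcons h (v, k, b)) <=
    (A h v k * (1 + 2 * l ^+ 2) + l * (A h v k * gain h v k b)) * (Phi h * expR (- a)).
  have -> : Phi (rcons h (v, k, b)) = expR (l * gain h v k b) * (Phi h * expR (- a)).
    by rewrite /Phi -!expRD; congr expR; rewrite excess_rcons size_rcons -natr1; ring.
  rewrite mulrA ler_wpM2r ?mulr_ge0 ?expR_ge0 //.
  have A0 := (A_dist h v).1 k; have := gain_itv h v k b => /andP[g0 g1].
  have -> : A h v k * (1 + 2 * l ^+ 2) + l * (A h v k * gain h v k b) =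
      A h v k * (1 + l * gain h v k b + 2 * l ^+ 2) by ring.
  rewrite ler_wpM2l //; apply: le_trans (expR_le_quadratic _) _; first by nra.
  by rewrite lerD2l ler_pM2l // exprMn ler_piMr ?sqr_ge0 //; nra.
apply: le_trans (ler_sum _ (fun k _ => step k)) _.
rewrite -mulr_suml big_split /= -mulr_suml -mulr_sumr (A_dist h v).2 mul1r.
rewrite mulrCA ler_piMr ?expR_ge0 // expRN ler_pdivrMr ?expR_gt0 // mul1r.
apply: le_trans (expR_ge1Dx _); rewrite /a.
by have := ler_wpM2l l0 (A_hedge h v b); lra.
Qed.

Lemma Pr_SReg (delta : R) : 0 < delta < 1 ->
  1 - delta <= Pr A x y [pred w | SReg x y (@Flin4 R d) w <=
    N.+1%:R * (16 + d%:R * ln (1 + T%:R)) + T%:R * eps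
    + Num.sqrt (8 * T%:R * ln (1 / delta))].
Proof.
move=> /andP[d0 d1]; set u := Num.sqrt _.
have u0 : 0 <= u by apply: sqrtr_ge0.
have ld : 0 <= ln (1 / delta).
  by rewrite ln_ge0 // ler_pdivlMr // mul1r ltW.
apply: (@Pr_ge_of_compl _ _ _ _ _ _ _ _ _
          [pred w | T%:R * eps + u < excess (transcript x y w)]) => // [w|].
  by rewrite /= -leNgt => e; have := SReg_le_excess w; lra.
rewrite PrE //.
have Te : 0 <= T%:R * eps by rewrite mulr_ge0.
(* For u >= 2 T the exponent chosen below could exceed 1/2, but then the bad event is empty because
   the excess is at most T. *)
have [uT|uT] := leP (2 * T%:R) u.
  rewrite /Ex big1 ?ltW // => w _ /=.
  have := excess_le_size (transcript x y w); rewrite size_transcript => eT.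
  have T0 : 0 <= T%:R :> R by [].
  by rewrite ltNge (_ : (_ <= _) = true) ?mulr0 //; lra.
have T0 : 0 < T%:R :> R by lra.
(* Minimises 2 T l^2 - l u; the minimum - u^2 / (8 T) equals ln delta by the choice of u. *)
pose l := u / (4 * T%:R).
have l0 : 0 <= l by rewrite divr_ge0 // mulr_ge0.
have l1 : l <= 2^-1 by rewrite ler_pdivrMr ?mulr_gt0 //; lra.
pose c := expR (- (l * (T%:R * eps + u))).
apply: le_trans (_ : Ex A x y (fun w => expR (l * excess (transcript x y w)) * c) <= _).
  apply: Ex_le => // w /=; case: ltP => [e|_]; last by rewrite mulr_ge0 ?expR_ge0.
  rewrite mulr1n -expRD -[leLHS]expR0 ler_expR -mulrBr.
  by rewrite mulr_ge0 // subr_ge0 ltW.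
rewrite /Ex; under eq_bigr do rewrite mulrA.
rewrite -mulr_suml.
have l01 : 0 <= l <= 2^-1 by rewrite l0 l1.
have := ler_wpM2r (expR_ge0 _ : 0 <= c) (Ex_expR_excess l01).
move/le_trans; apply; rewrite /c -expRD -[leRHS](lnK (d0 : delta \is Num.pos)) ler_expR.
have uu : u ^+ 2 = 8 * T%:R * - ln delta.
  by rewrite sqr_sqrtr ?mulr_ge0 // div1r lnV.
have -> : T%:R * (l * eps + 2 * l ^+ 2) - l * (T%:R * eps + u) = - u ^+ 2 / (8 * T%:R).
  by rewrite /l; field; rewrite gt_eqF.
rewrite uu (_ : - _ / _ = ln delta) //.
by field; rewrite gt_eqF.
Qed.

End Calibeating.

(** * Rates *)

(** Integer specification of the parameters: L = 1 + floor (log_2 T) stands in for the logarithm,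
    and N is the largest integer with N^2 d L <= T, or 1 if there is none. *)
Definition good_grid (T d L N : nat) : Prop :=
  [/\ (2 ^ L <= 2 * T < 2 * 2 ^ L)%N, (0 < N)%N,
      (N == 1)%N || (N ^ 2 * d * L <= T)%N & (T < N.+1 ^ 2 * d * L)%N].

Section Rates.
Variable R : realType.

Lemma ln2_itv : 2^-1 <= ln (2 : R) <= 1.
Proof.
have h2 : (2 : R)^-1 \is Num.pos by rewrite posrE invr_gt0.
apply/andP; split; last first.
  by have := @le_ln1Dx R 1; rewrite (_ : 1 + 1 = 2) //; apply; lra.
have := expR_ge1Dx (- 2^-1 : R); rewrite (_ : 1 + - 2^-1 = 2^-1 :> R); last lra.
rewrite -ler_ln ?posrE ?expR_gt0 // expRK lnV ?posrE //; lra.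
Qed.

Variables (T d L N : nat).
Hypotheses (T2 : (2 <= T)%N) (d1 : (1 <= d)%N) (gN : good_grid T d L N).

Let D : R := d%:R * ln T%:R.

Lemma lnT_ge : 2^-1 <= ln T%:R :> R.
Proof.
have /andP[l _] := ln2_itv; apply: le_trans l _.
by rewrite ler_ln ?posrE ?ltr0n ?ler_nat //; lia.
Qed.

Lemma D_ge : 2^-1 <= D.
Proof.
have := lnT_ge; have : 1 <= d%:R :> R by rewrite ler1n.
by rewrite /D; nra.
Qed.

Lemma T_gt0 : 0 < T%:R :> R. Proof. by rewrite ltr0n; lia. Qed.

(** Below, ln T <= L ln 2 <= L. Above, L <= 1 + ln T / ln 2 <= 1 + 2 ln T <= 4 ln T, using ln 2 >=
    1/2 and ln T >= 1/2. *)
Lemma log_approx : ln (T%:R : R) <= L%:R <= 4 * ln (T%:R : R).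
Proof.
have [/andP[L1 L2] _ _ _] := gN.
have /andP[l1 l2] := ln2_itv; have lT := lnT_ge; have T0 := T_gt0.
have Tn : (0 < T)%N by lia.
have e : ln (2 ^ L)%:R = L%:R * ln 2 :> R by rewrite natrX lnXn // mulr_natl.
have h1 : ln T%:R <= L%:R * ln 2 :> R.
  by rewrite -e ler_ln ?posrE ?ltr0n ?expn_gt0 // ler_nat; lia.
have h2 : L%:R * ln 2 <= ln 2 + ln T%:R :> R.
  rewrite -e -lnM ?posrE // -natrM ler_ln ?posrE ?ltr0n ?expn_gt0 ?muln_gt0 ?ler_nat //; lia.
have L0 : 0 <= L%:R :> R by [].
by apply/andP; split; nra.
Qed.

(** The analysis yields the rate sqrt (T D). For D <= T it implies the stated one, by trading
    D^(1/10) for T^(1/10). *)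
Lemma sqrt_TD_le : D <= T%:R -> Num.sqrt (T%:R * D) <= T%:R `^ (3 / 5) * D `^ (2 / 5).
Proof.
move=> DT; have T0 := T_gt0; have D0 : 0 < D by have := D_ge; lra.
have T0' := ltW T0; have D0' := ltW D0.
rewrite -[Num.sqrt (T%:R * D)]powR12_sqrt; last exact: mulr_ge0.
rewrite powRM //.
rewrite (_ : D `^ 2^-1 = D `^ (1 / 10) * D `^ (2 / 5)); last first.
  by rewrite -powRD ?(gt_eqF D0) ?implybT //; congr powR; field.
rewrite mulrA ler_wpM2r ?powR_ge0 //.
rewrite (_ : T%:R `^ (3 / 5) = T%:R `^ 2^-1 * T%:R `^ (1 / 10) :> R); last first.
  by rewrite -powRD ?(gt_eqF T0) ?implybT //; congr powR; field.
by rewrite ler_wpM2l ?powR_ge0 // ge0_ler_powR ?nnegrE //; lra.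
Qed.

Lemma sqrt_T_le : D <= T%:R -> Num.sqrt T%:R <= T%:R `^ (3 / 5) * D `^ (- (1 / 10)).
Proof.
move=> DT; have T0 := T_gt0; have D0 : 0 < D by have := D_ge; lra.
have T0' := ltW T0; have D0' := ltW D0.
rewrite powRN ler_pdivlMr ?powR_gt0 //.
rewrite (_ : T%:R `^ (3 / 5) = T%:R `^ 2^-1 * T%:R `^ (1 / 10) :> R); last first.
  by rewrite -powRD ?(gt_eqF T0) ?implybT //; congr powR; field.
rewrite -[Num.sqrt _]powR12_sqrt //.
by rewrite ler_wpM2l ?powR_ge0 // ge0_ler_powR ?nnegrE //; lra.
Qed.

Lemma T_le_rate : T%:R <= D -> T%:R <= T%:R `^ (3 / 5) * D `^ (2 / 5).
Proof.
move=> TD; have T0 := T_gt0; have D0 : 0 < D by have := D_ge; lra.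
have T0' := ltW T0; have D0' := ltW D0.
have {1}-> : T%:R = T%:R `^ (3 / 5) * T%:R `^ (2 / 5) :> R.
  rewrite -powRD ?(gt_eqF T0) ?implybT // (_ : _ + _ = 1); last by field.
  by rewrite powRr1.
by rewrite ler_wpM2l ?powR_ge0 // ge0_ler_powR ?nnegrE //; lra.
Qed.

(** With S = sqrt (T D), the experts cost at most 2 N * 34 D <= 68 S and the grid width at most 4 D
    <= 4 S, hence 72. *)
Lemma regret_rate : D <= T%:R ->
  N.+1%:R * (16 + d%:R * ln (1 + T%:R)) + T%:R * (4 * N%:R ^+ 2)^-1
  <= 72 * (T%:R `^ (3 / 5) * D `^ (2 / 5)).
Proof.
move=> DT; have T0 := T_gt0; have Dge := D_ge.
have D0 : 0 < D by lra.
have D0' := ltW D0; have T0' := ltW T0.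
have [_ N0 NT TN] := gN; have /andP[L1 L2] := log_approx.
apply: le_trans (_ : 72 * Num.sqrt (T%:R * D) <= _); last first.
  by rewrite ler_pM2l // sqrt_TD_le.
have ln1T : ln (1 + T%:R) <= 2 * ln T%:R :> R.
  rewrite mulr_natl -lnXn // ler_ln ?posrE ?exprn_gt0 ?ltr_pwDl // -natrX.
  by rewrite -(natrD _ 1 T) ler_nat; nia.
have d0 : 0 < d%:R :> R by rewrite ltr0n.
set S := Num.sqrt _.
have S0 : 0 <= S by apply: sqrtr_ge0.
have S2 : S ^+ 2 = T%:R * D by rewrite sqr_sqrtr // mulr_ge0.
have DS : D <= S.
  by rewrite -ler_sqr ?nnegrE // S2 expr2 ler_pM2r.
have n1 : 1 <= N%:R :> R by rewrite ler1n.
have dLD : d%:R * L%:R <= 4 * D by rewrite /D; nra.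
have DdL : D <= d%:R * L%:R by rewrite /D ler_pM2l.
(* For N = 1 this is D <= S; otherwise N^2 D^2 <= N^2 d L D <= T D. *)
have NS : N%:R * D <= S.
  case/orP: NT => [/eqP -> |NT]; first by rewrite mul1r.
  have : (N ^ 2 * d * L)%:R <= T%:R :> R by rewrite ler_nat.
  rewrite natrM natrM natrX -mulrA => {}NT.
  have ND0 : N%:R * D \is Num.nneg by rewrite nnegrE mulr_ge0.
  rewrite -ler_sqr // S2 exprMn [D ^+ 2]expr2 mulrA ler_pM2r //.
  by apply: le_trans NT; rewrite ler_wpM2l ?sqr_ge0.
have TS : T%:R * (4 * N%:R ^+ 2)^-1 <= 4 * D.
  have : (T%:R : R) <= (N.+1 ^ 2 * d * L)%:R by rewrite ler_nat ltnW.
  rewrite natrM natrM natrX -mulrA -natr1 => {}TN.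
  rewrite ler_pdivrMr; last by rewrite mulr_gt0 // exprn_gt0 // ltr0n.
  apply: le_trans TN _; apply: le_trans (_ : (N%:R + 1) ^+ 2 * (4 * D) <= _).
    by rewrite ler_wpM2l ?sqr_ge0.
  by rewrite mulrC ler_pM2l; [nra | lra].
have B16 : 16 + d%:R * ln (1 + T%:R) <= 34 * D.
  have : d%:R * ln (1 + T%:R) <= 2 * D by rewrite /D mulrCA ler_pM2l.
  lra.
have : N.+1%:R * (16 + d%:R * ln (1 + T%:R)) <= (2 * N%:R) * (34 * D).
  apply: ler_pM => //; last by rewrite -natr1; lra.
  by rewrite addr_ge0 // mulr_ge0 // ln_ge0 // lerDl.
by move: TS NS DS; lra.
Qed.

End Rates.

(** * Frame rules and cost bounds for RAM programs *)

Fixpoint nregs (c : cmd) : seq nat :=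
  match c with
  | NSet r _ => [:: r]
  | Seq c1 c2 | If _ c1 c2 => nregs c1 ++ nregs c2
  | For r _ c => r :: nregs c
  | _ => [::]
  end.

Fixpoint arrays (c : cmd) : seq nat :=
  match c with
  | RSet a _ _ => [:: a]
  | Seq c1 c2 | If _ c1 c2 => arrays c1 ++ arrays c2
  | For _ _ c => arrays c
  | _ => [::]
  end.

(** Syntactic check that every array write carries register [r] as its [n]-th index, so that writes
    for different values of [r] cannot collide. *)
Fixpoint indexed_by (n r : nat) (c : cmd) : bool :=
  match c with
  | RSet _ idx _ => if onth idx n is Some (NReg r') then r' == r else false
  | Seq c1 c2 | If _ c1 c2 => indexed_by n r c1 && indexed_by n r c2
  | For _ _ c => indexed_by n r c
  | _ => true
  end.

(** Loop bounds are registers of [s], which the command never assigns; bounds known on entry thus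
    hold throughout. *)
Fixpoint bounded_by (s : seq nat) (c : cmd) : bool :=
  match c with
  | NSet r _ => r \notin s
  | Seq c1 c2 | If _ c1 c2 => bounded_by s c1 && bounded_by s c2
  | For r e c =>
      [&& if e is NReg r' then r' \in s else false, r \notin s & bounded_by s c]
  | _ => true
  end.

Fixpoint nesting (c : cmd) : nat :=
  match c with
  | Seq c1 c2 | If _ c1 c2 => maxn (nesting c1) (nesting c2)
  | For _ _ c => (nesting c).+1
  | _ => 0
  end.

Fixpoint weight (c : cmd) : nat :=
  match c with
  | Skip => 1
  | NSet _ e => (ncost e).+1
  | RSet _ idx e => idxcost idx + rcost e
  | Seq c1 c2 => weight c1 + weight c2
  | If b c1 c2 => bcost b + (weight c1 + weight c2)
  | For _ e c => ncost e + (weight c).+1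
  end.

Section Frames.
Variable R : realType.
Implicit Types (m : memory R) (c : cmd).

Definition agree c m m' : Prop :=
  (forall r, r \notin nregs c -> nreg m' r = nreg m r) /\
  (forall a, a \notin arrays c -> forall idx, cell m' a idx = cell m a idx).

Lemma agree_refl c m : agree c m m. Proof. by []. Qed.

Lemma agree_trans c m1 m2 m3 : agree c m1 m2 -> agree c m2 m3 -> agree c m1 m3.
Proof.
move=> [n1 c1] [n2 c2]; split=> [r rc|a ac idx]; first by rewrite n2 // n1.
by rewrite c2 // c1.
Qed.

Lemma agree_sub c c' m m' : {subset nregs c <= nregs c'} -> {subset arrays c <= arrays c'} ->
  agree c m m' -> agree c' m m'.
Proof.
move=> nn aa [nE cE]; split=> [r rc|a ac]; [apply: nE|apply: cE].
  by apply: contra rc; apply: nn.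
by apply: contra ac; apply: aa.
Qed.

Lemma agree_set_nreg r e c m i : agree (For r e c) m (set_nreg r i m).
Proof. by split=> // r'; rewrite inE negb_or /= => /andP[/negPf ->]. Qed.

Lemma loop_inv (Q : nat -> memory R -> Prop) (f : memory R -> memory R) r n m :
  Q 0 m -> (forall i m', (i < n)%N -> Q i m' -> Q i.+1 (f (set_nreg r i m'))) ->
  Q n (loop f r n m).
Proof.
move=> Q0 step; rewrite /loop; have : (n <= n)%N by [].
elim: {1 3 4}n => // k IH kn; rewrite iteriS; apply: step => //.
by apply: IH; apply: ltnW.
Qed.

Lemma run_agree c m : agree c m (run c m).
Proof.
elim: c m => [|r e|a idx e|c1 IH1 c2 IH2|b c1 IH1 c2 IH2|r e c IH] m /=.
- exact: agree_refl.
- by split=> // r'; rewrite inE /= => /negPf ->.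
- by split=> // a' + idx'; rewrite inE /= => /negPf ->.
- apply: agree_trans (agree_sub _ _ (IH1 m)) (agree_sub _ _ (IH2 _)) => z zc;
    by rewrite mem_cat zc ?orbT.
- case: ifP => _; [apply: agree_sub (IH1 m)|apply: agree_sub (IH2 m)] => z zc;
    by rewrite mem_cat zc ?orbT.
- apply: (loop_inv (Q := fun _ m' => agree (For r e c) m m')) => // i m' _ mm'.
  apply: agree_trans mm' _; apply: agree_trans (agree_set_nreg r e c m' i) _.
  by apply: agree_sub (IH _) => // z zc; rewrite inE zc orbT.
Qed.

Lemma run_nreg c m r : r \notin nregs c -> nreg (run c m) r = nreg m r.
Proof. exact: (run_agree c m).1. Qed.

Lemma run_cell c m a idx : a \notin arrays c -> cell (run c m) a idx = cell m a idx.
Proof. by move=> ac; apply: (run_agree c m).2. Qed.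

Lemma run_indexed n r c m a idx : indexed_by n r c -> r \notin nregs c ->
  onth idx n != Some (nreg m r) -> cell (run c m) a idx = cell m a idx.
Proof.
elim: c m => [|r' e|a' idx' e|c1 IH1 c2 IH2|b c1 IH1 c2 IH2|r' e c IH] m //=.
- move=> H _ ne; case: ifP => // /andP[_ /eqP E]; move: ne.
  rewrite E onth_map; case: (onth idx' n) H => // -[] // r'' /eqP ->.
  by rewrite eqxx.
- move=> /andP[i1 i2]; rewrite mem_cat negb_or => /andP[n1 n2] ne.
  by rewrite IH2 ?IH1 // run_nreg.
- move=> /andP[i1 i2]; rewrite mem_cat negb_or => /andP[n1 n2] ne.
  by case: ifP => _; rewrite ?IH1 ?IH2.
- move=> ic; rewrite inE negb_or => /andP[/negPf rr rc] ne.
  apply: (loop_inv (Q := fun _ m' => nreg m' r = nreg m r /\ cell m' a idx = cell m a idx)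
    _ _).2 => // i m' _ [e1 e2].
  have e3 : nreg (set_nreg r' i m') r = nreg m r by rewrite /= rr.
  by rewrite run_nreg // e3 IH // e3.
Qed.

(* The iterations write to disjoint sets of cells, so the [j]-th one sees its own
   cells as they were before the loop, and nothing later overwrites them. *)
Lemma run_for_at n r e c m j : indexed_by n r c -> r \notin nregs c -> (j < neval m e)%N ->
  exists m', [/\ agree (For r e c) m m',
    forall a idx, onth idx n = Some j -> cell m' a idx = cell m a idx &
    forall a idx, onth idx n = Some j ->
      cell (run (For r e c) m) a idx = cell (run c (set_nreg r j m')) a idx].
Proof.
move=> ic rc jn; pose Lp k := loop (run c) r k m.
have [agL keep] : agree (For r e c) m (Lp j) /\
    forall a idx, onth idx n = Some j -> cell (Lp j) a idx = cell m a idx.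
  suff : forall k, (k <= j)%N -> agree (For r e c) m (Lp k) /\
    forall a idx, onth idx n = Some j -> cell (Lp k) a idx = cell m a idx by apply.
  move=> k kj.
  apply: (loop_inv (Q := fun k m' => (k <= j)%N -> agree (For r e c) m m' /\
    forall a idx, onth idx n = Some j -> cell m' a idx = cell m a idx)) (kj) => //.
  move=> i m' _ IH ij; have [ag kp] := IH (ltnW ij); split.
    apply: agree_trans ag _; apply: agree_trans (agree_set_nreg r e c m' i) _.
    by apply: agree_sub (run_agree _ _) => // z zc; rewrite inE zc orbT.
  move=> a idx idxj; rewrite (run_indexed _ ic rc) ?kp //= eqxx idxj.
  by apply/eqP => -[ji]; rewrite ji ltnn in ij.
exists (Lp j); split=> // a idx idxj /=.
suff : forall k, (j < k)%N -> cell (Lp k) a idx = cell (Lp j.+1) a idx.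
  by move/(_ _ jn) ->; rewrite /Lp /loop iteriS.
move=> k jk; rewrite -(subnKC jk); elim: (k - j.+1)%N => [|i IH]; first by rewrite addn0.
have -> : Lp (j.+1 + i.+1)%N = run c (set_nreg r (j.+1 + i)%N (Lp (j.+1 + i)%N)).
  by rewrite addnS /Lp /loop iteriS.
rewrite (run_indexed _ ic rc) ?IH //= eqxx idxj.
by apply/eqP => -[]; lia.
Qed.

(** The index and the summand need only be evaluated in states differing from [m] at [r] and in
    array [a], which is all that the accumulating loop changes. *)
Lemma run_accum r e a idx t m idx0 (F : nat -> R) :
  (forall i m', (forall r', r' != r -> nreg m' r' = nreg m r') -> nreg m' r = i ->
     (forall a' idx', a' != a -> cell m' a' idx' = cell m a' idx') -> (i < neval m e)%N ->
     map (neval m') idx = idx0 /\ reval m' t = F i) ->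
  cell (run (For r e (RSet a idx (RAdd (RCell a idx) t))) m) a idx0 =
  cell m a idx0 + \sum_(i < neval m e) F i.
Proof.
move=> H /=; pose Q k m' := (k <= neval m e)%N ->
  [/\ forall r', r' != r -> nreg m' r' = nreg m r',
      forall a' idx', a' != a -> cell m' a' idx' = cell m a' idx' &
      cell m' a idx0 = cell m a idx0 + \sum_(i < k) F i].
set f := fun m' => _.
suff : Q (neval m e) (loop f r (neval m e) m) by case.
rewrite {}/f; apply: loop_inv.
  by split=> //; rewrite big_ord0 addr0.
move=> k m' kn IH _; have [n' c' e'] := IH (ltnW kn).
have [//| |//|//|i1 i2] := H k (set_nreg r k m').
- by move=> r' /negPf rr /=; rewrite rr n' // rr.
- by rewrite /= eqxx.
split=> /=.
- by move=> r' /negPf rr; rewrite rr n' // rr.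
- by move=> a' idx' /negPf aa; rewrite aa /= c' // aa.
- by rewrite i1 !eqxx /= e' i2 big_ord_recr /= addrA.
Qed.

(** Each level of nesting contributes a factor [B]. Since [weight] counts both branches of a test,
    it bounds the cost of a pass whichever branch is taken. *)
Lemma cost_le (s : seq nat) c m B : bounded_by s c -> (0 < B)%N ->
  (forall r, r \in s -> nreg m r <= B)%N -> (cost c m <= weight c * B ^ nesting c)%N.
Proof.
move=> + B0; have Bpos k : (0 < B ^ k)%N by rewrite expn_gt0 B0.
have Bmono i j : (i <= j)%N -> (B ^ i <= B ^ j)%N by move=> ij; apply: leq_pexp2l.
have notin c' : bounded_by s c' -> forall r, r \in s -> r \notin nregs c'.
  elim: c' => //= [r' e|c1 IH1 c2 IH2|b c1 IH1 c2 IH2|r' e c' IH'].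
  - by move=> rs r ris; rewrite inE; apply: contraNneq rs => <-.
  - by move=> /andP[b1 b2] r rs; rewrite mem_cat negb_or IH1 ?IH2.
  - by move=> /andP[b1 b2] r rs; rewrite mem_cat negb_or IH1 ?IH2.
  - move=> /and3P[_ rs bc] r ris; rewrite inE negb_or IH' // andbT.
    by apply: contraNneq rs => <-.
elim: c m => [|r e|a idx e|c1 IH1 c2 IH2|b c1 IH1 c2 IH2|r e c IH] m /=.
- by [].
- by rewrite expn0 muln1.
- by rewrite expn0 muln1.
- move=> /andP[b1 b2] mB; rewrite mulnDl leq_add //.
    by apply: leq_trans (IH1 m b1 mB) _; rewrite leq_mul2l Bmono ?leq_maxl ?orbT.
  apply: leq_trans (IH2 _ b2 _) _; last by rewrite leq_mul2l Bmono ?leq_maxr ?orbT.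
  by move=> r rs; rewrite run_nreg ?mB ?notin.
- move=> /andP[b1 b2] mB; rewrite !mulnDl leq_add ?leq_pmulr //.
  case: ifP => _.
    apply: leq_trans (IH1 m b1 mB) _; apply: leq_trans (leq_addr _ _).
    by rewrite leq_mul2l Bmono ?leq_maxl ?orbT.
  apply: leq_trans (IH2 m b2 mB) _; apply: leq_trans (leq_addl _ _).
  by rewrite leq_mul2l Bmono ?leq_maxr ?orbT.
- move=> /and3P[]; case: e => // r' r's rs bc mB /=.
  rewrite mulnDl leq_add ?leq_pmulr //.
  apply: leq_trans (_ : \sum_(i < nreg m r') (weight c).+1 * B ^ nesting c <= _)%N.
    apply: leq_sum => i _; rewrite mulSn -add1n leq_add //.
    apply: IH => // r0 r0s /=.
    case: eqP => [r0r|_]; first by rewrite -r0r r0s in rs.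
    have -> : nreg (loop (run c) r i m) r0 = nreg m r0; last exact: mB.
    apply: (run_agree (For r (NConst i) c) m).1; rewrite inE negb_or notin // andbT.
    by apply: contraNneq rs => <-.
  by rewrite sum_nat_const card_ord expnS mulnCA leq_mul2l leq_mul2r mB ?orbT.
Qed.

End Frames.

(** * The program *)

(** Register 8 holds 2^L and register 7 holds L. The loop imitates a while loop that doubles as long
    as 2^L <= T. *)
Definition log_code : cmd :=
  Seq (NSet 8 (NConst 1))
      (For 10 (NReg 0)
        (If (NLe (NReg 8) (NReg 0))
            (Seq (NSet 8 (NAdd (NReg 8) (NReg 8))) (NSet 7 (NAdd (NReg 7) (NConst 1))))
            Skip)).

(** Linear search in place of a square root; the last candidate that passes is the largest. The test
    is over the reals because naturals cannot be multiplied. *)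
Definition grid_code : cmd :=
  let k := RNat (NAdd (NReg 10) (NConst 1)) in
  Seq (NSet 2 (NConst 1))
      (For 10 (NReg 0)
        (If (RLe (RMul (RMul (RMul k k) (RNat (NReg 1))) (RNat (NReg 7))) (RNat (NReg 0)))
            (NSet 2 (NAdd (NReg 10) (NConst 1)))
            Skip)).

Definition swap_init : cmd :=
  Seq log_code (Seq grid_code (NSet 5 (NAdd (NReg 2) (NConst 1)))).

(* Array 2 holds [cov - 1], so that the zero-initialised memory already
   represents the empty history, and array 3 the moment vectors; for the context
   x at hand, arrays 4 and 7 receive u = x *m cov and u . x, array 8 the clipped
   predictions, array 9 their distances to the grid points. *)
Definition row_code : cmd :=
  Seq (RSet 4 [:: NReg 10; NReg 11] (RCell 0 [:: NReg 11]))
      (For 12 (NReg 1)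
        (RSet 4 [:: NReg 10; NReg 11]
          (RAdd (RCell 4 [:: NReg 10; NReg 11])
                (RMul (RCell 2 [:: NReg 10; NReg 11; NReg 12]) (RCell 0 [:: NReg 12]))))).

Definition dot_code (a : nat) (e : rexp) : cmd :=
  Seq (RSet a [:: NReg 10] (RNat (NConst 0)))
      (For 11 (NReg 1)
        (RSet a [:: NReg 10] (RAdd (RCell a [:: NReg 10])
                                   (RMul (RCell 4 [:: NReg 10; NReg 11]) e)))).

Definition gap_code : cmd :=
  let w := RCell 8 [:: NReg 10] in
  let one := RNat (NConst 1) in
  let zero := RNat (NConst 0) in
  Seq (RSet 8 [:: NReg 10] (RDiv (RCell 6 [:: NReg 10]) (RAdd one (RCell 7 [:: NReg 10]))))
 (Seq (If (RLe w zero) (RSet 8 [:: NReg 10] zero)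
          (If (RLe one w) (RSet 8 [:: NReg 10] one) Skip))
      (RSet 9 [:: NReg 10] (RSub w (RDiv (RNat (NReg 10)) (RNat (NReg 2)))))).

Definition expert_code : cmd :=
  Seq (For 11 (NReg 1) row_code)
 (Seq (dot_code 6 (RCell 3 [:: NReg 10; NReg 11]))
 (Seq (dot_code 7 (RCell 0 [:: NReg 11])) gap_code)).

(** Keeps the last index with nonnegative gap, so the next grid point has a negative one. The
    default 0 is sound since w_0 >= 0. *)
Definition crossing_code : cmd :=
  Seq (NSet 6 (NConst 0))
      (For 10 (NReg 5)
        (If (RLe (RNat (NConst 0)) (RCell 9 [:: NReg 10])) (NSet 6 (NReg 10)) Skip)).

Definition clear_cell : cmd := RSet 1 [:: NReg 10] (RNat (NConst 0)).

Definition clear_code : cmd := For 10 (NReg 5) clear_cell.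

Definition output_code : cmd :=
  let i := NReg 6 in
  let j := NAdd (NReg 6) (NConst 1) in
  let total := RSub (RCell 9 [:: i]) (RCell 9 [:: j]) in
  If (NLe (NReg 2) i) (RSet 1 [:: i] (RNat (NConst 1)))
     (Seq (RSet 1 [:: i] (RDiv (RSub (RNat (NConst 0)) (RCell 9 [:: j])) total))
          (RSet 1 [:: j] (RDiv (RCell 9 [:: i]) total))).

Definition swap_predict : cmd :=
  Seq (For 10 (NReg 5) expert_code) (Seq crossing_code (Seq clear_code output_code)).

(** Arrays 4 and 7 still hold the values of the prediction phase, and only the drawn grid point,
    register 3, is updated. *)
Definition cov_cell : cmd :=
  RSet 2 [:: NReg 3; NReg 11; NReg 12]
    (RSub (RCell 2 [:: NReg 3; NReg 11; NReg 12])
          (RDiv (RMul (RCell 4 [:: NReg 3; NReg 11]) (RCell 4 [:: NReg 3; NReg 12]))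
                (RAdd (RNat (NConst 1)) (RCell 7 [:: NReg 3])))).

Definition cov_code : cmd := For 11 (NReg 1) (For 12 (NReg 1) cov_cell).

Definition moment_cell : cmd :=
  RSet 3 [:: NReg 3; NReg 11]
    (RAdd (RCell 3 [:: NReg 3; NReg 11])
          (RMul (RNat (NReg 4)) (RCell 0 [:: NReg 11]))).

Definition moment_code : cmd := For 11 (NReg 1) moment_cell.

Definition swap_update : cmd := Seq cov_code moment_code.

Definition swap_program : program := Program swap_init swap_predict swap_update.

(** * Correctness of the initialisation *)

Section Correctness.
Variable R : realType.
Implicit Types m : memory R.

Lemma log_code_correct m (T := nreg m 0) (m' := run log_code m) : nreg m 7 = 0%N ->
  nreg m' 0 = T /\ (0 < T -> 2 ^ nreg m' 7 <= 2 * T < 2 * 2 ^ nreg m' 7)%N.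
Proof.
move=> L0; rewrite /m' /=; set f := fun _ => _; set m0 := set_nreg 8 1 m.
(* The disjunction in the invariant says that doubling has either stopped or occurred in each
   iteration so far. *)
have : (0 < T)%N -> forall Q : nat -> memory R -> Prop, Q = (fun k m' =>
   [/\ nreg m' 0 = T, nreg m' 8 = (2 ^ nreg m' 7)%N, (nreg m' 8 <= 2 * T)%N &
       (T < nreg m' 8)%N || (nreg m' 7 == k)]) -> Q T (loop f 10 T m0).
  move=> T0 Q QE; apply: loop_inv; rewrite {}QE /=.
    by split=> //; rewrite ?L0 //; lia.
  move=> k m1 kT [e0 e8 le8 alt]; rewrite /f /= e0.
  case: (leqP (nreg m1 8) T) => h8; split=> //=.
  - by rewrite addn1 expnS -e8; lia.
  - by lia.
  - by move: alt; rewrite ltnNge h8 /= => /eqP ->; rewrite addn1 eqxx orbT.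
  - by rewrite h8.
rewrite -/T.
move=> H; split; first by apply: (loop_inv (Q := fun _ m1 => nreg m1 0 = T)) => // k m1 _ e;
  rewrite /f /=; case: ifP.
move=> T0; have [e0 e8 le8 alt] := H T0 _ erefl.
rewrite -e8 le8 /=; case/orP: alt => [|/eqP e7]; first by lia.
(* If doubling never stopped, register 8 is 2^T > T. *)
by have := ltn_expl T (isT : (1 < 2)%N); rewrite e8 e7; lia.
Qed.

Lemma grid_code_correct m (T := nreg m 0) (d := nreg m 1) (L := nreg m 7)
    (m' := run grid_code m) : (1 <= d)%N -> (1 <= L)%N ->
  (0 < T)%N -> [/\ (0 < nreg m' 2)%N,
    (nreg m' 2 == 1)%N || (nreg m' 2 ^ 2 * d * L <= T)%N &
    (T < (nreg m' 2).+1 ^ 2 * d * L)%N].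
Proof.
move=> d1 L1 T0; rewrite /m' /=; set f := fun _ => _; set m0 := set_nreg 2 1 m.
rewrite -/T.
pose Q k m1 := [/\ nreg m1 0 = T, nreg m1 1 = d, nreg m1 7 = L & [/\ (0 < nreg m1 2)%N,
   (nreg m1 2 == 1)%N || (nreg m1 2 ^ 2 * d * L <= T)%N &
   forall i, (0 < i <= k)%N -> (i ^ 2 * d * L <= T)%N -> (i <= nreg m1 2)%N]].
have : Q T (loop f 10 T m0).
  apply: loop_inv => [|k m1 kT [e0 e1 e7 [n0 nT nmax]]].
    by split=> //; split=> // i; lia.
  rewrite /f /= e0 e1 e7 -!natrM ler_nat addn1 mulnn.
  case: ifP => h; split=> //=; split=> //=.
  - by rewrite h orbT.
  - by move=> i; lia.
  - move=> i /andP[i0 ik] iT; have [ik'|ik'] := leqP i k; first by apply: nmax; rewrite ?i0.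
    have {ik'}E : i = k.+1 by lia.
    by move: iT; rewrite E h.
move=> [_ _ _ [n0 nT nmax]]; split=> //.
set n := nreg _ 2 in n0 nT nmax *; rewrite ltnNge; apply/negP => nT'.
(* As d and L are positive, a passing candidate n + 1 is at most T and was therefore tried. *)
have nT1 : (n.+1 <= T)%N.
  apply: leq_trans nT'; rewrite -mulnn -mulnA -[X in (X <= _)%N]muln1 -mulnA leq_mul2l /=.
  by rewrite muln_gt0 /= muln_gt0 d1 L1.
by have := nmax n.+1; rewrite nT1 nT' ltnn => /(_ isT isT).
Qed.

Lemma after_init_correct (T d : nat) (m := after_init R swap_program T d) :
  (2 <= T)%N -> (1 <= d)%N ->
  [/\ nreg m 0 = T, nreg m 1 = d, nreg m 5 = (nreg m 2).+1,
      forall a idx, cell m a idx = 0 & exists L, good_grid T d L (nreg m 2)].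
Proof.
move=> T2 d1; rewrite /m /after_init; set m0 := start R T d.
have Tm : nreg m0 0 = T by [].
have [e0 HL] := @log_code_correct m0 erefl.
have T0 : (0 < T)%N by lia.
set m1 := run log_code m0 in e0 HL.
have d1m : nreg m1 1 = d by rewrite run_nreg.
have {}HL := HL T0; rewrite Tm in e0 HL.
have L1 : (1 <= nreg m1 7)%N.
  by case: (nreg m1 7) HL => // /andP[]; rewrite expn0; lia.
have [] := @grid_code_correct m1; rewrite ?e0 ?d1m // => n0 nT nmax.
rewrite (_ : run _ _ = set_nreg 5 (nreg (run grid_code m1) 2 + 1) (run grid_code m1)) //.
split.
- by rewrite [LHS]run_nreg.
- by rewrite [LHS]run_nreg.
- by rewrite /= addn1.
- by move=> a idx; rewrite [LHS]run_cell // run_cell.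
- by exists (nreg m1 7); split.
Qed.

End Correctness.

(** * Correctness of a round *)

Section Predict.
Variable R : realType.
Implicit Types m : memory R.

(** Coordinate of x *m cov as read from memory; the separate first term restores the identity that
    array 2 omits. *)
Definition mem_u m (p i : nat) : R :=
  cell m 0 [:: i] + \sum_(j < nreg m 1) cell m 2 [:: p; i; val j] * cell m 0 [:: val j].

Definition mem_dot m (p : nat) (F : nat -> R) : R := \sum_(i < nreg m 1) mem_u m p i * F i.

Lemma mem_u_eq m m' p i : nreg m' 1 = nreg m 1 ->
  (forall idx, cell m' 0 idx = cell m 0 idx) ->
  (forall idx, cell m' 2 idx = cell m 2 idx) -> mem_u m' p i = mem_u m p i.
Proof.
by move=> e1 e0 e2; rewrite /mem_u e1 e0; congr (_ + _); apply: eq_bigr => j _; rewrite e0 e2.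
Qed.

Lemma row_code_correct m (p := nreg m 10) (i := nreg m 11) :
  cell (run row_code m) 4 [:: p; i] = mem_u m p i.
Proof.
rewrite /row_code [run _ _]/=; set m0 := set_cell _ _ _ _.
have := @run_accum R 12%N (NReg 1) 4%N [:: NReg 10; NReg 11]
  (RMul (RCell 2 [:: NReg 10; NReg 11; NReg 12]) (RCell 0 [:: NReg 12])) m0 [:: p; i]
  (fun j => cell m 2 [:: p; i; j] * cell m 0 [:: j]).
rewrite [run _ _]/= => -> /=; first by rewrite !eqxx.
move=> j m' e e12 c _; rewrite (e 10%N) // (e 11%N) //; split=> //.
by rewrite !c // e12.
Qed.

Lemma dot_code_correct m a e (p := nreg m 10) (F : nat -> R) : a != 4%N ->
  (forall i, (i < nreg m 1)%N -> cell m 4 [:: p; i] = mem_u m p i) ->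
  (forall i m', (forall r', r' != 11%N -> nreg m' r' = nreg m r') -> nreg m' 11 = i ->
     (forall a' idx', a' != a -> cell m' a' idx' = cell m a' idx') ->
     reval m' e = F i) ->
  cell (run (dot_code a e) m) a [:: p] = mem_dot m p F.
Proof.
move=> a4 u4 eF; rewrite /dot_code [run _ _]/=; set m0 := set_cell _ _ _ _.
have := @run_accum R 11%N (NReg 1) a [:: NReg 10]
  (RMul (RCell 4 [:: NReg 10; NReg 11]) e) m0 [:: p]
  (fun i => mem_u m p i * F i).
rewrite [run _ _]/= => ->; first by rewrite /= !eqxx /= add0r.
have c0 a' idx : a' != a -> cell m0 a' idx = cell m a' idx by rewrite /= => /negPf ->.
move=> i m' em e11 c i_lt; rewrite /= (em 10%N) //; split=> //.
rewrite c 1?eq_sym // c0 1?eq_sym // e11 u4 // (eF i) //.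
by move=> a' idx' aa; rewrite c // c0.
Qed.

Lemma gap_code_correct m (p := nreg m 10) :
  cell (run gap_code m) 9 [:: p] =
  clip (cell m 6 [:: p] / (1 + cell m 7 [:: p])) - p%:R / (nreg m 2)%:R.
Proof.
rewrite /gap_code /= !eqxx /= -/p /clip.
set w := cell m 6 _ / _.
by case: (w <= 0) => /=; last case: (1 <= w) => /=; rewrite -/p ?eqxx /= ?eqxx.
Qed.

Lemma expert_code_correct m (p := nreg m 10) (m' := run expert_code m) :
  [/\ forall i, (i < nreg m 1)%N -> cell m' 4 [:: p; i] = mem_u m p i,
      cell m' 7 [:: p] = mem_dot m p (fun i => cell m 0 [:: i]) &
      cell m' 9 [:: p] =
        clip (mem_dot m p (fun i => cell m 3 [:: p; i])
              / (1 + mem_dot m p (fun i => cell m 0 [:: i]))) - p%:R / (nreg m 2)%:R].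
Proof.
set m1 := run (For 11 (NReg 1) row_code) m.
set m2 := run (dot_code 6 (RCell 3 [:: NReg 10; NReg 11])) m1.
set m3 := run (dot_code 7 (RCell 0 [:: NReg 11])) m2.
have -> : m' = run gap_code m3 by [].
have u1 i : (i < nreg m 1)%N -> cell m1 4 [:: p; i] = mem_u m p i.
  move=> id.
  have [//|//|//|m0 [[n0 c0] keep ->]] := @run_for_at R 1%N 11%N (NReg 1) row_code m i; last by [].
  have := row_code_correct (set_nreg 11 i m0).
  rewrite [nreg _ 11]/= [nreg _ 10]/= n0 // => ->.
  by apply: mem_u_eq => [|idx|idx]; rewrite ?c0 //= n0.
have d1 : nreg m1 1 = nreg m 1 by rewrite run_nreg.
have uE m0 c : agree c m m0 -> 1%N \notin nregs c -> 0%N \notin arrays c -> 2%N \notin arrays c ->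
    mem_u m0 p =1 mem_u m p.
  by move=> [n0 c0] ? ? ? i; apply: mem_u_eq => [|idx|idx]; rewrite ?n0 ?c0.
have uE1 : mem_u m1 p =1 mem_u m p by apply: uE (run_agree _ _) _ _ _.
have uE2 : mem_u m2 p =1 mem_u m p.
  by apply: (uE _ (Seq (For 11 (NReg 1) row_code) (dot_code 6 (RCell 3 [:: NReg 10; NReg 11]))));
    first exact: run_agree.
have p1 : nreg m1 10 = p by rewrite run_nreg.
have p2 : nreg m2 10 = p by rewrite run_nreg.
have p3 : nreg m3 10 = p by rewrite run_nreg.
have d2 : nreg m2 1 = nreg m 1 by rewrite run_nreg.
have u2 i : (i < nreg m 1)%N -> cell m2 4 [:: p; i] = mem_u m p i.
  by move=> id; rewrite run_cell // u1.
have c6 : cell m2 6 [:: p] = mem_dot m p (fun i => cell m 3 [:: p; i]).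
  rewrite /m2 -{1}p1 (dot_code_correct (F := fun i => cell m 3 [:: p; i])) //.
  - by rewrite /mem_dot d1 p1; apply: eq_bigr => i _; rewrite uE1.
  - by move=> i id; rewrite p1 uE1 u1 // -d1.
  - move=> i m0 n0 e11 c0 /=; rewrite n0 // e11 c0 // p1 run_cell //.
have c7 : cell m3 7 [:: p] = mem_dot m p (fun i => cell m 0 [:: i]).
  rewrite /m3 -{1}p2 (dot_code_correct (F := fun i => cell m 0 [:: i])) //.
  - by rewrite /mem_dot d2 p2; apply: eq_bigr => i _; rewrite uE2.
  - by move=> i id; rewrite p2 uE2 u2 // -d2.
  - by move=> i m0 n0 e11 c0 /=; rewrite e11 c0 // run_cell // run_cell.
split.
- by move=> i id; rewrite run_cell // run_cell // u2.
- by rewrite run_cell.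
- rewrite -{1}p3 gap_code_correct p3 c7 (run_cell _ _ (_ : 6%N \notin _)) // c6.
  by rewrite !run_nreg.
Qed.

Lemma crossing_code_correct m (n := nreg m 5) (i := nreg (run crossing_code m) 6) :
  (0 < n)%N -> 0 <= cell m 9 [:: 0%N] ->
  [/\ (i < n)%N, 0 <= cell m 9 [:: i] & forall k, (i < k < n)%N -> cell m 9 [:: k] < 0].
Proof.
move=> n0 g0; rewrite /i /crossing_code [run _ _]/=; set f := fun _ => _; set m0 := set_nreg 6 0 m.
pose Q k m' := [/\ forall idx, cell m' 9 idx = cell m 9 idx, (nreg m' 6 <= k.-1)%N,
  0 <= cell m 9 [:: nreg m' 6] & forall k', (nreg m' 6 < k' < k)%N -> cell m 9 [:: k'] < 0].
have : Q n (loop f 10 n m0).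
  apply: loop_inv => [|k m1 kn [c9 i1 gi gk]]; first by split=> // k' /=; rewrite andbF.
  rewrite /f /= c9; case: ifP => h; split=> //=.
  - by move=> k' /=; lia.
  - by lia.
  - move=> k' /andP[ik kk]; have [kk'|kk'] := ltnP k' k; first by apply: gk; rewrite ik.
    have -> : k' = k by lia.
    by rewrite ltNge h.
by move=> [_ i1 gi gk]; split=> //; rewrite -(prednK n0) ltnS.
Qed.

Lemma output_code_correct m N (i := nreg m 6) (g := fun k => cell m 9 [:: k]) :
  nreg m 2 = N -> (forall k, (k <= N)%N -> cell m 1 [:: k] = 0) ->
  forall k, (k <= N)%N -> cell (run output_code m) 1 [:: k] =
    if (N <= i)%N then (k == i)%:R
    else if k == i then (0 - g i.+1) / (g i - g i.+1)
    else if k == i.+1 then g i / (g i - g i.+1) else 0.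
Proof.
move=> mN c1 k kN; rewrite /output_code /= mN -/i.
have eqc (a b : nat) : ([:: a] == [:: b]) = (a == b) by rewrite eqseq_cons andbT.
case: ifP => iN /=; rewrite ?addn1 !eqc; first by case: eqP => // _; rewrite c1.
rewrite c1 //; case: (eqVneq k i) => [->|_]; last by [].
by rewrite (ltn_eqF (ltnSn i)).
Qed.

Lemma expert_itv d N (h : seq (round R d N)) v k : 0 <= expert h v k <= 1.
Proof. exact: clip_itv. Qed.

(** Invariant between rounds. Scratch arrays are left out because each prediction recomputes
    them. *)
Definition represents d N (h : seq (round R d N)) m : Prop :=
  [/\ nreg m 1 = d, nreg m 2 = N, nreg m 5 = N.+1,
      forall (p : 'I_N.+1) (i j : 'I_d),
        cell m 2 [:: val p; val i; val j] = cov (data p h) i j - (i == j)%:R &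
      forall (p : 'I_N.+1) (i : 'I_d), cell m 3 [:: val p; val i] = moment (data p h) 0 i].

Lemma load_context_agree d (v : context R d) m :
  agree (RSet 0 [::] (RNat (NConst 0))) m (load_context v m).
Proof.
rewrite /load_context; elim: (enum _) => [|i s IH] //=.
apply: agree_trans IH _; split=> // a; rewrite inE /= => /negPf aa idx.
by rewrite aa.
Qed.

Lemma load_context_cell d (v : context R d) m i : cell (load_context v m) 0 [:: val i] = v 0 i.
Proof.
rewrite /load_context; have := mem_enum 'I_d i; rewrite inE.
elim: (enum _) => [|j s IH] //=; rewrite inE; have [->|ij] := eqVneq i j.
  by rewrite eqxx.
move=> /= /IH; rewrite eqseq_cons andbT; case: eqP => // /val_inj E.
by rewrite E eqxx in ij.
Qed.

Section Round.
Variables (d N : nat) (h : seq (round R d N)) (m : memory R) (v : context R d).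
Hypotheses (N_gt0 : (0 < N)%N) (hm : represents h m).

Let m0 := load_context v m.
Let m1 := run (For 10 (NReg 5) expert_code) m0.
Let m' := run swap_predict m0.

Let u (p : 'I_N.+1) : 'rV[R]_d := v *m cov (data p h).

Lemma mem_u_load (p : 'I_N.+1) (i : 'I_d) : mem_u m0 p i = u p 0 i.
Proof.
have [n1 _ _ c2 _] := hm; have [n0 c0] := load_context_agree v m.
rewrite /mem_u n0 // n1 load_context_cell /u mxE.
under eq_bigr => j _ do rewrite c0 // c2 load_context_cell mulrBl.
have delta : \sum_(j < d) (i == j)%:R * v 0 j = v 0 i.
  rewrite (bigD1 i) //= eqxx mul1r big1 ?addr0 // => j.
  by rewrite eq_sym => /negPf ->; rewrite mul0r.
rewrite sumrB delta addrC subrK; apply: eq_bigr => j _.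
by rewrite -[in LHS]cov_sym mxE mulrC.
Qed.

Lemma mem_dot_load (p : 'I_N.+1) (F : nat -> R) (x : 'rV[R]_d) :
  (forall i : 'I_d, F i = x 0 i) -> mem_dot m0 p F = dot (u p) x.
Proof.
have [n1 _ _ _ _] := hm; have [n0 _] := load_context_agree v m.
move=> Fx; rewrite /mem_dot n0 // n1 dotE; apply: eq_bigr => i _.
by rewrite mem_u_load Fx.
Qed.

Lemma experts_correct (p : 'I_N.+1) :
  [/\ forall i : 'I_d, cell m1 4 [:: val p; val i] = u p 0 i,
      cell m1 7 [:: val p] = dot (u p) v &
      cell m1 9 [:: val p] = expert h v p - grid R p].
Proof.
have [n1 n2 n5 c2 c3] := hm; have [nl cl] := load_context_agree v m.
have pN : (p < neval m0 (NReg 5))%N by rewrite /= nl // n5.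
have [//|//|k [[na ca] keep cE]] := @run_for_at R 0%N 10%N (NReg 5) expert_code m0 p _ _ pN.
have [] := expert_code_correct (set_nreg 10 p k).
have nk r : r \in [:: 1%N; 2%N] -> nreg k r = nreg m0 r.
  by rewrite !inE => /orP[] /eqP ->; rewrite na.
have ck a idx : a \in [:: 0%N; 2%N; 3%N] -> cell k a idx = cell m0 a idx.
  by rewrite !inE => /or3P[] /eqP ->; rewrite ca.
have uE i : mem_u (set_nreg 10 p k) p i = mem_u m0 p i.
  by apply: mem_u_eq => [|idx|idx] /=; rewrite ?nk ?ck.
have dE F G : (forall i : nat, F i = G i) -> mem_dot (set_nreg 10 p k) p F = mem_dot m0 p G.
  move=> FG; rewrite /mem_dot /= nk //; apply: eq_bigr => i _.
  by rewrite uE FG.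
rewrite [nreg _ 10]/= [nreg _ 1]/= [nreg _ 2]/= !nk // ![nreg m0 _]nl // n1 n2.
rewrite !(dE (fun i => cell (set_nreg 10 p k) 0 [:: i]) (fun i => cell m0 0 [:: i])); last first.
  by move=> i /=; rewrite ck.
rewrite (dE _ (fun i => cell m0 3 [:: val p; i])); last by move=> i /=; rewrite ck.
rewrite (@mem_dot_load p (fun i => cell m0 0 [:: i]) v) => [|i]; last exact: load_context_cell.
rewrite (@mem_dot_load p _ (moment (data p h))) => [|i]; last by rewrite cl // c3.
move=> e4 e7 e9; split.
- by move=> i; rewrite cE // e4 ?ltn_ord // uE mem_u_load.
- by rewrite cE // e7.
- by rewrite cE // e9.
Qed.

Lemma predict_correct (q := fun k : 'I_N.+1 => cell m' 1 [:: val k]) :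
  [/\ agree swap_predict m0 m', forall (p : 'I_N.+1) (i : 'I_d), cell m' 4 [:: val p; val i] = u p 0 i,
     forall p : 'I_N.+1, cell m' 7 [:: val p] = dot (u p) v, is_distribution q &
     forall b : bool, \sum_k q k * gain h v k b <= (4 * N%:R ^+ 2)^-1].
Proof.
have [n1 n2 n5 c2 c3] := hm; have [nl cl] := load_context_agree v m.
pose tail := Seq crossing_code (Seq clear_code output_code).
have E : m' = run tail m1 by [].
suff [dq hq] : is_distribution q /\
    forall b : bool, \sum_k q k * gain h v k b <= (4 * N%:R ^+ 2)^-1.
  split=> //; first exact: run_agree.
    by move=> p i; have [<- _ _] := experts_correct p; rewrite E run_cell.
  by move=> p; have [_ <- _] := experts_correct p; rewrite E run_cell.
pose m2 := run crossing_code m1; pose m3 := run clear_code m2.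
have n51 : nreg m1 5 = N.+1 by rewrite run_nreg // nl // n5.
have g9 (p : 'I_N.+1) : cell m1 9 [:: val p] = expert h v p - grid R p.
  by have [] := experts_correct p.
pose p0 : 'I_N.+1 := ord0.
have [||iN gi gk] := @crossing_code_correct m1; rewrite ?n51 //.
  by rewrite (g9 p0) /grid mul0r subr0; have /andP[] := expert_itv h v p0.
rewrite n51 in iN gk; pose i : 'I_N.+1 := Ordinal iN.
have i3 : nreg m3 6 = i by rewrite run_nreg.
have c31 k : (k <= N)%N -> cell m3 1 [:: k] = 0.
  move=> kN; have kn : (k < neval m2 (NReg 5))%N by rewrite /= run_nreg // n51.
  have [//|//|z [_ _ ->]] := @run_for_at R 0%N 10%N (NReg 5) clear_cell m2 k _ _ kn; last by [].
  by rewrite /= !eqxx.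
have g39 (k : 'I_N.+1) : cell m3 9 [:: val k] = expert h v k - grid R k.
  by rewrite run_cell // run_cell // g9.
have n32 : nreg m3 2 = N by rewrite !run_nreg // nl // n2.
have qE (k : 'I_N.+1) : q k = _ := output_code_correct n32 c31 (ltn_ord k : (k <= N)%N).
have eqv (a b : 'I_N.+1) : (val a == val b) = (a == b) by [].
rewrite i3 in qE; have gi' : 0 <= expert h v i - grid R i by rewrite -(g9 i).
(* A crossing at N forces the expert to predict exactly 1, as it is clipped there; otherwise i and i
   + 1 bracket a sign change. *)
have [Ni|iN'] := leqP N i.
  apply: (hedge_one (i := i)) => [|k]; last by rewrite qE Ni.
  have iE : i = N :> nat by apply/eqP; rewrite eqn_leq Ni -ltnS iN.
  have gr : grid R i = 1 by rewrite /grid iE divff // pnatr_eq0 -lt0n.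
  by have /andP[] := expert_itv h v i; move: gi'; rewrite gr; lra.
have jN : (i.+1 < N.+1)%N by [].
pose j : 'I_N.+1 := Ordinal jN.
apply: (hedge_two (i := i) (j := j)) => // [||k].
- by rewrite -subr_ge0.
- by rewrite -subr_lt0 -(g9 j); apply: gk; rewrite /= ltnSn.
- rewrite qE leqNgt iN' /= (g39 i) (g39 j).
  by rewrite -(eqv k i) -(eqv k j) sub0r opprB.
Qed.

Lemma update_correct k b (m2 := load_outcome (val k) b m') :
  represents (rcons h (v, k, b)) (run swap_update m2).
Proof.
have [n1 n2 n5 c2 c3] := hm; have [nl cl] := load_context_agree v m.
have [[na ca] c4 c7 _ _] := predict_correct.
have nE r : r \in [:: 1%N; 2%N; 5%N] -> nreg m2 r = nreg m r.
  by rewrite !inE => /or3P[] /eqP -> /=; rewrite na // nl.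
have d2 : nreg m2 1 = d by rewrite nE.
pose m3 := run cov_code m2.
have c3E a idx : a != 2%N -> cell m3 a idx = cell m' a idx.
  by move=> a2; rewrite run_cell // inE.
(* Every write has the drawn point as its first index, so other experts keep their data. *)
have c2' (p : 'I_N.+1) (i j : 'I_d) : p != k ->
    cell m3 2 [:: val p; val i; val j] = cell m' 2 [:: val p; val i; val j].
  by move=> pk; rewrite (run_indexed (n := 0) (r := 3)).
(* Only iteration (i, j) writes this cell, so it is updated once, from its old value. *)
have c2k (i j : 'I_d) : cell m3 2 [:: val k; val i; val j] =
    cell m' 2 [:: val k; val i; val j] - u k 0 i * u k 0 j / (1 + dot (u k) v).
  have iM : (i < neval m2 (NReg 1))%N by rewrite [neval _ _]d2.
  have [//|//|z [[nz cz] keep ->]] := @run_for_at R 1%N 11%N (NReg 1) (For 12 (NReg 1) cov_cell) m2 i _ _ iM; last by [].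
  set z1 := set_nreg 11 i z.
  have jM : (j < neval z1 (NReg 1))%N by rewrite [neval _ _](nz 1%N isT) d2.
  have [//|//|z' [[nz' cz'] keep' ->]] := @run_for_at R 2%N 12%N (NReg 1) cov_cell z1 j _ _ jM; last by [].
  rewrite /= !nz' //= !nz //= !eqxx /=.
  rewrite !(cz' 4%N) // (cz' 7%N) // keep' // /z1 /=.
  by rewrite !(cz 4%N) // (cz 7%N) // keep //= !c4 c7.
have c3k (i : 'I_d) : cell (run moment_code m3) 3 [:: val k; val i] =
    cell m' 3 [:: val k; val i] + b%:R * v 0 i.
  have iM : (i < neval m3 (NReg 1))%N by rewrite [neval _ _]run_nreg // d2.
  have [//|//|z [[nz cz] keep ->]] := @run_for_at R 1%N 11%N (NReg 1) moment_cell m3 i _ _ iM; last by [].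
  rewrite /= !nz //= !(run_nreg (c := cov_code)) //= !eqxx /= keep // cz // !c3E //.
  by rewrite (ca 0%N) // load_context_cell.
have c3' (p : 'I_N.+1) (i : 'I_d) : p != k ->
    cell (run moment_code m3) 3 [:: val p; val i] = cell m' 3 [:: val p; val i].
  move=> pk; rewrite (run_indexed (n := 0) (r := 3)) ?c3E //.
  by rewrite run_nreg.
have E : run swap_update m2 = run moment_code m3 by [].
split; rewrite E.
- by rewrite run_nreg // run_nreg // (nE 1%N).
- by rewrite run_nreg // run_nreg // (nE 2%N).
- by rewrite run_nreg // run_nreg // (nE 5%N).
- move=> p i j; rewrite run_cell // data_rcons; have [<-|kp] := eqVneq k p; last first.
    by rewrite c2' ?(eq_sym p) // ca // cl // c2.
  rewrite c2k ca // cl // c2 cov_rcons !mxE big_ord1 !mxE.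
  by rewrite -/(u k); ring.
- move=> p i; rewrite data_rcons; have [<-|kp] := eqVneq k p; last first.
    by rewrite c3' ?(eq_sym p) // ca // cl // c3.
  by rewrite c3k ca // cl // c3 moment_rcons !mxE.
Qed.

End Round.
End Predict.

(** * Running time and regret of the program *)

(** The cube matches the three nested loops of prediction, and the 2 pays for reading the context
    and sampling. The weights enter as variables so that their numerals stay folded. *)
Lemma rounds_cost_le (R : realType) T d n (m : memory R) (h : seq (round R d n)) wp wu :
  (0 < d)%N -> (n <= T)%N ->
  weight swap_predict = wp -> weight swap_update = wu ->
  nreg m 1 = d -> nreg m 5 = n.+1 ->
  (rounds_cost swap_program m h <= size h * ((2 + wp + wu) * (T + d) ^ 3))%N.
Proof.
move=> d0 nT wpE wuE.
have B0 : (0 < T + d)%N by lia.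
elim: h m => [//|[[v k] b] h IH] m m1 m5; rewrite mulSn.
have -> : rounds_cost swap_program m ((v, k, b) :: h) =
  (d + cost swap_predict (load_context v m) + n.+1 +
   cost swap_update (load_outcome k b (after_predict swap_program v m)) +
   rounds_cost swap_program (run swap_update
     (load_outcome k b (after_predict swap_program v m))) h)%N by [].
have [nl _] := load_context_agree v m.
have after_m r : r \in [:: 1%N; 5%N] ->
    nreg (load_outcome k b (after_predict swap_program v m)) r = nreg m r.
  by rewrite !inE => /orP[] /eqP ->; rewrite [LHS]run_nreg // nl.
apply: leq_add; last first.
  by apply: IH; rewrite [LHS]run_nreg // after_m.
have cp : (cost swap_predict (load_context v m) <= wp * (T + d) ^ 3)%N.
  rewrite -wpE; apply: (cost_le (s := [:: 1; 5])) => // r; rewrite !inE => /orP[] /eqP ->.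
    by rewrite nl // m1; lia.
  by rewrite nl // m5; lia.
have cu : (cost swap_update (load_outcome k b (after_predict swap_program v m))
           <= wu * (T + d) ^ 2)%N.
  rewrite -wuE; apply: (cost_le (s := [:: 1%N])) => // r; rewrite inE => /eqP ->.
  by rewrite after_m // m1; lia.
have B13 : (T + d <= (T + d) ^ 3)%N by rewrite -{1}[(T + d)%N]expn1 leq_pexp2l.
have B23 : (wu * (T + d) ^ 2 <= wu * (T + d) ^ 3)%N.
  by rewrite leq_mul2l leq_pexp2l ?orbT.
rewrite !mulnDl mul2n -addnn.
have := leq_trans cu B23; move: cp.
rewrite -/(after_predict swap_program v m).
move: (wp * _)%N (wu * (T + d) ^ 3)%N => a c.
move: (cost _ _) (cost _ _) ((T + d) ^ 3)%N B13 => x y z B13.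
lia.
Qed.

Section Assembly.
Variables (R : realType) (T d : nat).
Hypotheses (T2 : (2 <= T)%N) (d1 : (1 <= d)%N).

Let P := swap_program.
Let N := grid_size R P T d.

Lemma grid_size_good : exists L, good_grid T d L N.
Proof. by have [] := after_init_correct R T2 d1. Qed.

Lemma grid_size_gt0 : (0 < N)%N.
Proof. by have [L []] := grid_size_good. Qed.

Lemma grid_size_le : (N <= T)%N.
Proof.
have [L [_ N0 /orP[/eqP ->|NT] TN]] := grid_size_good; first by lia.
have L0 : (0 < L)%N by case: (L) TN => //; rewrite muln0.
apply: leq_trans NT; rewrite -mulnn -mulnA -mulnA leq_pmulr //.
by rewrite muln_gt0 N0 muln_gt0 d1.
Qed.

Definition memory_after (h : seq (round R d N)) : memory R :=
  foldl (@after_round R P d N) (after_init R P T d) h.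

Lemma memory_after_represents h : represents h (memory_after h).
Proof.
have [e0 e1 e5 c0 _] := after_init_correct R T2 d1.
elim/last_ind: h => [|h [[v k] b] IH].
  split=> //= [p i j|p i]; rewrite c0.
    by rewrite /cov /gram /data /= big_nil addr0 invmx1 mxE subrr.
  by rewrite /moment big_nil mxE.
rewrite /memory_after foldl_rcons -/(memory_after h).
exact: (update_correct v grid_size_gt0 IH).
Qed.

Lemma forecaster_correct h v (A := @forecaster_of R P T d N) :
  is_distribution (A h v) /\
  forall b : bool, \sum_k A h v k * gain h v k b <= (4 * N%:R ^+ 2)^-1.
Proof. by have [] := predict_correct v grid_size_gt0 (memory_after_represents h). Qed.

Lemma running_time_le (h : seq (round R d N)) wi wp wu :
  weight swap_init = wi -> weight swap_predict = wp -> weight swap_update = wu ->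
  size h = T -> (running_time P T h <= (wi + (2 + wp + wu)) * (T + d) ^ 4)%N.
Proof.
move=> wiE wpE wuE hT; have [e0 e1 e5 _ _] := after_init_correct R T2 d1.
have B0 : (0 < T + d)%N by lia.
rewrite /running_time mulnDl leq_add //.
  apply: leq_trans (_ : wi * (T + d) ^ nesting swap_init <= _)%N.
    rewrite -wiE; apply: (cost_le (s := [:: 0%N])) => // r; rewrite inE => /eqP -> /=; lia.
  by rewrite leq_mul2l leq_pexp2l ?orbT.
apply: leq_trans (rounds_cost_le h d1 grid_size_le wpE wuE e1 e5) _; rewrite hT expnS [leqRHS]mulnCA.
by rewrite leq_mul2r leq_addr orbT.
Qed.

End Assembly.

Theorem theorem3 (R : realType) :
  exists (C : R) (P : program),
  0 < C /\ efficient R P /\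
  forall T d : nat, (2 <= T)%N -> (1 <= d)%N ->
  let N := grid_size R P T d in
  let A : forecaster R d N := @forecaster_of R P T d N in
  (0 < N)%N /\
  forall (x : 'I_T -> context R d) (y : 'I_T -> bool),
  (forall t, contexts (x t)) ->
  [/\ forall (w : draws N T) (t : 'I_T), is_distribution (chosen_dist A x y w t),
      forall delta : R, 0 < delta < 1 ->
        1 - delta <=
        Pr A x y [pred w | SReg x y (@Flin4 R d) w <=
          C * (T%:R `^ (3 / 5) * (d%:R * ln T%:R) `^ (2 / 5)
               + T%:R `^ (3 / 5) * (d%:R * ln T%:R) `^ (- (1 / 10))
                 * Num.sqrt (ln (1 / delta)))]
    & Ex A x y (SReg x y (@Flin4 R d)) <=
        C * (T%:R `^ (3 / 5) * (d%:R * ln T%:R) `^ (2 / 5)) ].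
Proof.
exists 72, swap_program; split; first by [].
split.
  have [wi wiE] : exists wi, weight swap_init = wi by eexists.
  have [wp wpE] : exists wp, weight swap_predict = wp by eexists.
  have [wu wuE] : exists wu, weight swap_update = wu by eexists.
  (* One constant serves as coefficient and as exponent, so 4 is added to reach the required
     degree. *)
  exists (wi + (2 + wp + wu) + 4)%N => T d T2 d1 x y w _.
  apply: leq_trans (running_time_le T2 d1 wiE wpE wuE (size_transcript x y w)) _.
  by apply: leq_mul; [exact: leq_addr | rewrite leq_pexp2l ?leq_addl //; lia].
move=> T d T2 d1 N A; split; first exact: grid_size_gt0.
move=> x y xX.
have A_dist h v : is_distribution (A h v) by have [] := forecaster_correct T2 d1 h v.
have A_hedge h v b : \sum_k A h v k * gain h v k b <= (4 * N%:R ^+ 2)^-1.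
  by have [_] := forecaster_correct T2 d1 h v.
have eps0 : 0 <= (4 * N%:R ^+ 2)^-1 :> R by rewrite invr_ge0 mulr_ge0 ?sqr_ge0.
have [L gN] : exists L, good_grid T d L N := grid_size_good R T2 d1.
clearbody A; clearbody N.
set D : R := d%:R * ln T%:R; set X := T%:R `^ (3 / 5) * D `^ (2 / 5).
have X0 : 0 <= X by rewrite mulr_ge0 ?powR_ge0.
(* For D <= T the regret analysis applies; for larger D the rate exceeds T, which bounds the regret
   for every draw. *)
have [DT|/ltW TD] := leP D T%:R.
  have rate : _ <= 72 * X := @regret_rate R T d L N T2 d1 gN DT.
  split=> [w t|delta d01|]; first exact: A_dist.
    apply: le_trans (Pr_SReg d1 eps0 A_dist A_hedge y xX d01) _.
    apply: Pr_le => // w /=; move/le_trans; apply.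
    rewrite [72 * _]mulrDr lerD //; have /andP[d0 dlt1] := d01.
    have l0 : 0 <= ln (1 / delta) by rewrite ln_ge0 // ler_pdivlMr // mul1r ltW.
    have sT := @sqrt_T_le R T d T2 d1 DT.
    rewrite -mulrA sqrtrM // sqrtrM ?mulr_ge0 // !mulrA ler_wpM2r ?sqrtr_ge0 //.
    rewrite -mulrA; apply: ler_pM => //; rewrite ?sqrtr_ge0 //.
    (* The constant sqrt 8 of the deviation term is absorbed into 72. *)
    apply: le_trans (_ : Num.sqrt (72 ^+ 2) <= _); last by rewrite sqrtr_sqr ger0_norm.
    by rewrite ler_sqrt; lra.
  by apply: le_trans (Ex_SReg d1 A_dist A_hedge y xX) rate.
have TX := @T_le_rate R T d T2 d1 TD.
have SReg_triv (w : draws N T) : SReg x y (@Flin4 R d) w <= 72 * X.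
  apply: le_trans (SReg_le_T x y w) _; apply: le_trans TX _.
  by rewrite ler_peMl //; lra.
split=> [w t|delta /andP[d0 _]|]; first exact: A_dist.
  apply: le_trans (_ : 1 <= _); first by lra.
  rewrite PrE // -[leLHS](Ex_cst x y A_dist 1); apply: Ex_le => // w /=.
  rewrite ler1n lt0b (le_trans (SReg_triv w)) //.
  by rewrite ler_pM2l // lerDl mulr_ge0 ?sqrtr_ge0 // mulr_ge0 ?powR_ge0.
by rewrite -[leRHS](Ex_cst x y A_dist); apply: Ex_le.
Qed.
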